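(* Let $u,v,w\in S^{k,n}$ be Grassmannian permutations. Then the equivariant Gromov-Witten invariants are $$C^w_{uv}(y,q)=\langle w|\,\mathfrak{S}_u(X_1^q,\ldots,X_k^q|y)\,|v\rangle ,$$ where the right hand side is computed with the natural pairing $\bigwedge^kV^*[q^{\pm1}]\otimes\bigwedge^kV[q^{\pm1}]\to R[q^{\pm1}]$, with $\langle w|=v^{w_1}\wedge\cdots\wedge v^{w_k}$ and $|v\rangle=v_{v_1}\wedge\cdots\wedge v_{v_k}$.
   Context: Fix $n\ge2$ and $1\le k\le n$. Let $R=\mathbb{Z}[y_1,\ldots,y_n]$, and $y_j:=0$ for $j>n$. $S^{k,n}\subset S_n$ is the set of Grassmannian permutations $w=[w_1\ldots w_n]$ (one-line notation), i.e. $w_1<\cdots<w_k$ and $w_{k+1}<\cdots<w_n$; they are in bijection with partitions $\lambda(w)=(\lambda_1,\ldots,\lambda_k)$ inside the $k\times(n-k)$ rectangle via $w_j=\lambda_{k+1-j}+j$. Put $(x|y)^m=\prod_{i=1}^m(x-y_i)$. The factorial Schur polynomial is $s_\lambda(x_1,\ldots,x_k|y)=\det\big((x_j|y)^{\lambda_i+k-i}\big)_{1\le i,j\le k}/\prod_{i<j}(x_i-x_j)$, and $h_r=s_{(r)}(x_1,\ldots,x_k|y)$. For $w\in S^{k,n}$ the double Schubert polynomial is $\mathfrak{S}_w(x_1,\ldots,x_k|y)=s_{\lambda(w)}(x_1,\ldots,x_k|y)$. The equivariant quantum cohomology ring is $$qH_T^*(\mathrm{Gr}(k;n))=R[q^{\pm1}][x_1,\ldots,x_k]^{S_k}/\langle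 h_{n-k+1},\ldots,h_{n-1},h_n+(-1)^kq\rangle ,$$ with product $\star$ and basis over $R[q^{\pm1}]$ given by the Schubert classes $\sigma_w$ = class of $s_{\lambda(w)}(x_1,\ldots,x_k|y)$, $w\in S^{k,n}$. The equivariant Gromov-Witten invariants are defined by $\sigma_u\star\sigma_v=\sum_{w\in S^{k,n}}C^w_{uv}(y,q)\sigma_w$. $V=R^n$ with standard basis $v_1,\ldots,v_n$ and dual basis $v^1,\ldots,v^n$ of $V^*$; $[q^{\pm1}]$ denotes extension of scalars to $R[q^{\pm1}]$. The pairing on exterior powers is the one with $\langle v^{a_1}\wedge\cdots\wedge v^{a_k},v_{b_1}\wedge\cdots\wedge v_{b_k}\rangle=\det(\delta_{a_ib_j})$. The quantised Chern root is the matrix $$X^q=(-1)^{k-1}q\,E_{1,n}+\sum_{i=1}^{n-1}E_{i+1,i}+\sum_{i=1}^ny_iE_{ii},\qquad E_{ij}v_j=v_i .$$ $X_i^q$ acts on $V^{\otimes k}[q^{\pm1}]$ as $X^q$ in the $i$-th tensor factor and as the identity in the others. Symmetric polynomials in $X^q_1,\ldots,X^q_k$ descend to $\bigwedge^kV[q^{\pm1}]$. *)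

(* Defs.v *)
From HB Require Import structures.
From mathcomp Require Import all_boot perm all_algebra.
From mathcomp.multinomials Require Import mpoly.
From mathcomp Require Import boolp classical_sets.

Set Implicit Arguments.
Unset Strict Implicit.
Unset Printing Implicit Defensive.

Import GRing.Theory.
Local Open Scope ring_scope.
Local Open Scope quotient_scope.

(* Laurent polynomials R[q, q^-1] over a domain R: the subring of the field of
   fractions of R[q] consisting of the f such that f q^m lies in R[q] for
   some m. *)
Section Laurent.
Variable R : idomainType.

Definition laurent_pred : pred {fraction {poly R}} :=
  fun f => `[< exists (m : nat) (p : {poly R}),
    f * (tofrac 'X) ^+ m = tofrac p >].

Lemma laurent_subring_closed : subring_closed laurent_pred.
Proof.
split.
- by apply/asboolP; exists 0%N, 1; rewrite expr0 mulr1 tofrac1.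
- move=> f g /asboolP[a [p Ef]] /asboolP[b [r Eg]]; apply/asboolP.
  exists (a + b)%N, (p * 'X ^+ b - r * 'X ^+ a).
  rewrite tofracB !tofracM !tofracXn -Ef -Eg mulrBl exprD; congr (_ - _).
    by rewrite mulrA.
  by rewrite [_ ^+ a * _]mulrC mulrA.
- move=> f g /asboolP[a [p Ef]] /asboolP[b [r Eg]]; apply/asboolP.
  by exists (a + b)%N, (p * r); rewrite tofracM -Ef -Eg exprD mulrACA.
Qed.

HB.instance Definition _ :=
  GRing.isSubringClosed.Build {fraction {poly R}} laurent_pred
    laurent_subring_closed.

Record laurent := Laurent {
  laurent_val :> {fraction {poly R}};
  _ : laurent_pred laurent_val }.

HB.instance Definition _ := [isSub for laurent_val].
HB.instance Definition _ := [Choice of laurent by <:].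
HB.instance Definition _ := [SubChoice_isSubComNzRing of laurent by <:].

Lemma laurent_tofrac_subproof (p : {poly R}) : laurent_pred (tofrac p).
Proof. by apply/asboolP; exists 0%N, p; rewrite expr0 mulr1. Qed.

Lemma laurent_qinv_subproof : laurent_pred (tofrac 'X)^-1.
Proof.
apply/asboolP; exists 1%N, 1; rewrite expr1 tofrac1 mulVf //.
by rewrite tofrac_eq0 polyX_eq0.
Qed.

Definition laurentC (c : R) : laurent := Laurent (laurent_tofrac_subproof c%:P).
Definition laurent_q : laurent := Laurent (laurent_tofrac_subproof 'X).
Definition laurent_qinv : laurent := Laurent laurent_qinv_subproof.

Lemma laurent_mulqV : laurent_q * laurent_qinv = 1.
Proof. by apply/val_inj; rewrite /= divff // tofrac_eq0 polyX_eq0. Qed.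

Definition laurent_unit : pred laurent :=
  fun f => `[< exists g : laurent, g * f = 1 >].
Definition laurent_inv (f : laurent) : laurent :=
  if pselect (exists g : laurent, g * f = 1) is left h
  then sval (cid h) else f.

Fact laurent_mulVr : {in laurent_unit, left_inverse 1 laurent_inv *%R}.
Proof.
move=> f /asboolP fU; rewrite /laurent_inv.
by case: pselect => // h; case: (cid h).
Qed.
Fact laurent_unitPl f g : g * f = 1 -> laurent_unit f.
Proof. by move=> fg; apply/asboolP; exists g. Qed.
Fact laurent_inv_out : {in [predC laurent_unit], laurent_inv =1 id}.
Proof.
move=> f; rewrite inE => /asboolP fU; rewrite /laurent_inv.
by case: pselect.
Qed.
HB.instance Definition _ := GRing.ComNzRing_hasMulInverse.Build laurent
  laurent_mulVr laurent_unitPl laurent_inv_out.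

Fact laurent_idomain : GRing.integral_domain_axiom laurent.
Proof.
move=> f g /(congr1 val) /= /eqP; rewrite mulf_eq0 -!(inj_eq val_inj).
by [].
Qed.
HB.instance Definition _ :=
  GRing.ComUnitRing_isIntegral.Build laurent laurent_idomain.

Fact laurentC_zmod : zmod_morphism laurentC.
Proof. by move=> a b; apply/val_inj; rewrite /= polyCB tofracB. Qed.
Fact laurentC_monoid : monoid_morphism laurentC.
Proof.
split; first by apply/val_inj; rewrite /= polyC1 tofrac1.
by move=> a b; apply/val_inj; rewrite /= polyCM tofracM.
Qed.
HB.instance Definition _ := GRing.isZmodMorphism.Build R laurent laurentC
  laurentC_zmod.
HB.instance Definition _ := GRing.isMonoidMorphism.Build R laurent laurentC
  laurentC_monoid.
End Laurent.

(* {ideal_quot _} is only a Z-module for a subgroup and needs a proper ideal to be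
   a ring; here are the quotient module by a submodule and the quotient ring by
   a finitely generated ideal, not assumed to be proper. *)
Section QuotientModule.
Variables (A : nzRingType) (V : lmodType A) (I : {pred V}).
Hypothesis I_submod : submod_closed I.

Definition submod : {pred V} := let _ := I_submod in I.
HB.instance Definition _ := GRing.isZmodClosed.Build V submod
  (GRing.submod_closedB I_submod).
HB.instance Definition _ := GRing.isSubmodClosed.Build A V submod I_submod.

Definition quotmod := {ideal_quot submod}.
HB.instance Definition _ : EqQuotient V (Quotient.equiv submod) quotmod :=
  EqQuotient.on quotmod.
HB.instance Definition _ := Choice.on quotmod.
HB.instance Definition _ := ZmodQuotient.on quotmod.

Lemma quotmod_eqP (x y : V) :
  reflect (\pi_quotmod x = \pi_quotmod y) (x - y \in submod).
Proof. by rewrite Quotient.idealrBE; exact: eqP. Qed.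

Lemma quotmod_reprP (x : V) : repr (\pi_quotmod x) - x \in submod.
Proof. by apply/quotmod_eqP; rewrite reprK. Qed.

Definition quotmod_scale (a : A) := lift_op1 quotmod ( *:%R a).

Fact pi_quotmod_scale a :
  {morph \pi_quotmod : x / a *: x >-> quotmod_scale a x}.
Proof.
move=> x; unlock quotmod_scale; apply/esym/quotmod_eqP.
by rewrite -scalerBr rpredZ // quotmod_reprP.
Qed.

Fact quotmod_scalerA a b x :
  quotmod_scale a (quotmod_scale b x) = quotmod_scale (a * b) x.
Proof. by elim/quotW: x => x; rewrite -!pi_quotmod_scale scalerA. Qed.
Fact quotmod_scale1r : left_id 1 quotmod_scale.
Proof. by elim/quotW => x; rewrite -pi_quotmod_scale scale1r. Qed.
Fact quotmod_scalerDr : right_distributive quotmod_scale +%R.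
Proof.
move=> a; elim/quotW => x; elim/quotW => y.
by rewrite -!raddfD -!pi_quotmod_scale -raddfD scalerDr.
Qed.
Fact quotmod_scalerDl x : {morph quotmod_scale^~ x : a b / a + b}.
Proof.
by elim/quotW: x => x a b; rewrite -!pi_quotmod_scale -raddfD scalerDl.
Qed.
HB.instance Definition _ := GRing.Zmodule_isLmodule.Build A quotmod
  quotmod_scalerA quotmod_scale1r quotmod_scalerDr quotmod_scalerDl.
HB.instance Definition _ := GRing.isScalable.Build A V quotmod *:%R
  \pi_quotmod pi_quotmod_scale.
End QuotientModule.

Section QuotientAlgebra.
Variables (A : comNzRingType) (S : comAlgType A) (m : nat) (g : 'I_m -> S).

Definition gen_ideal : pred S :=
  fun f => `[< exists c : 'I_m -> S, f = \sum_(i < m) c i * g i >].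

Fact gen_ideal_submod : submod_closed gen_ideal.
Proof.
split.
  by apply/asboolP; exists (fun=> 0); rewrite big1 // => i _; rewrite mul0r.
move=> a f f' /asboolP[c ->] /asboolP[c' ->]; apply/asboolP.
exists (fun i => a *: c i + c' i); rewrite scaler_sumr -big_split /=.
by apply: eq_bigr => i _; rewrite mulrDl scalerAl.
Qed.

Fact gen_ideal_mull f f' : f' \in gen_ideal -> f * f' \in gen_ideal.
Proof.
move=> /asboolP[c ->]; apply/asboolP; exists (fun i => f * c i).
by rewrite mulr_sumr; apply: eq_bigr => i _; rewrite mulrA.
Qed.

Definition quotalg := quotmod gen_ideal_submod.
HB.instance Definition _ : EqQuotient S (Quotient.equiv (submod gen_ideal_submod)) quotalg :=
  EqQuotient.on quotalg.
HB.instance Definition _ := Choice.on quotalg.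
HB.instance Definition _ := ZmodQuotient.on quotalg.
HB.instance Definition _ := GRing.Lmodule.on quotalg.

Definition quotalg_one : quotalg := \pi_quotalg 1.
Definition quotalg_mul := lift_op2 quotalg *%R.

Fact pi_quotalg_mul :
  {morph \pi_quotalg : x y / x * y >-> quotalg_mul x y}.
Proof.
move=> x y; unlock quotalg_mul; apply/esym/quotmod_eqP.
set x' := repr _; set y' := repr _.
have -> : x' * y' - x * y = y' * (x' - x) + x * (y' - y).
  by rewrite !mulrBr addrA [y' * x]mulrC subrK [y' * x']mulrC.
by rewrite rpredD // gen_ideal_mull // quotmod_reprP.
Qed.

Fact quotalg_mulA : associative quotalg_mul.
Proof.
by do 3![elim/quotW => ?]; rewrite -!pi_quotalg_mul mulrA.
Qed.
Fact quotalg_mulC : commutative quotalg_mul.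
Proof. by do 2![elim/quotW => ?]; rewrite -!pi_quotalg_mul mulrC. Qed.
Fact quotalg_mul1 : left_id quotalg_one quotalg_mul.
Proof. by elim/quotW => ?; rewrite -!pi_quotalg_mul mul1r. Qed.
Fact quotalg_mulDl : left_distributive quotalg_mul +%R.
Proof.
do 3![elim/quotW => ?].
by rewrite -raddfD -!pi_quotalg_mul -raddfD mulrDl.
Qed.
HB.instance Definition _ := GRing.Zmodule_isComPzRing.Build quotalg
  quotalg_mulA quotalg_mulC quotalg_mul1 quotalg_mulDl.
Fact pi_quotalg_monoid : monoid_morphism \pi_quotalg.
Proof. by split=> // x y; rewrite pi_quotalg_mul. Qed.
HB.instance Definition _ := GRing.isMonoidMorphism.Build S quotalg
  \pi_quotalg pi_quotalg_monoid.
End QuotientAlgebra.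

Section SymPoly.
Variables (k : nat) (A : comNzRingType).
Record sympoly := SymPoly {
  sympoly_val :> {mpoly A[k]};
  _ : sympoly_val \is symmetric }.
HB.instance Definition _ := [isSub for sympoly_val].
HB.instance Definition _ := [Choice of sympoly by <:].
HB.instance Definition _ := [SubChoice_isSubComNzRing of sympoly by <:].
HB.instance Definition _ := [SubZmodule_isSubLmodule of sympoly by <:].
HB.instance Definition _ := [SubNzRing_SubLmodule_isSubLalgebra of sympoly by <:].
HB.instance Definition _ := [SubLalgebra_isSubAlgebra of sympoly by <:].
End SymPoly.

Section FactorialSchur.
Variables (k : nat) (A : idomainType) (y : nat -> A).
Implicit Types (i j : 'I_k) (l : 'I_k -> nat) (p : {mpoly A[k]}).

(* (x_j | y)^m, with y_1, y_2, ... numbered from 0 *)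
Definition fpow j (m : nat) : {mpoly A[k]} := \prod_(a < m) ('X_j - (y a)%:MP).

(* With 1-based i the exponent is l_i + k - i. *)
Definition fschur_num l : {mpoly A[k]} :=
  \det (\matrix_(i < k, j < k) fpow j (l i + (k - i.+1))).

Definition vdm : {mpoly A[k]} :=
  \prod_(i < k) \prod_(j < k | (i < j)%N) ('X_i - 'X_j).

(* substitution x_i := x_j, used to show that vdm divides fschur_num *)
Definition collapse i j p : {mpoly A[k]} :=
  p \mPo [tuple (if a == i then 'X_j else 'X_a) | a < k].

Fact collapseX i j a : collapse i j 'X_a = if a == i then 'X_j else 'X_a.
Proof. by rewrite /collapse comp_mpolyXU -tnth_nth tnth_mktuple. Qed.

Fact collapse_dvd i j p : exists r, p - collapse i j p = ('X_i - 'X_j) * r.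
Proof.
have mulP p1 p2 : (exists r, p1 - collapse i j p1 = ('X_i - 'X_j) * r) ->
    (exists r, p2 - collapse i j p2 = ('X_i - 'X_j) * r) ->
    exists r, p1 * p2 - collapse i j (p1 * p2) = ('X_i - 'X_j) * r.
  move=> [r1 E1] [r2 E2]; exists (r1 * p2 + collapse i j p1 * r2).
  rewrite /collapse rmorphM /= -/(collapse i j p1) -/(collapse i j p2).
  by rewrite mulrDr mulrA -E1 mulrCA -E2 mulrBl mulrBr addrA subrK.
have oneP : exists r, 1 - collapse i j 1 = ('X_i - 'X_j) * r.
  by exists 0; rewrite /collapse rmorph1 subrr mulr0.
elim/mpolyind: p => [|c m p _ _ [r Er]].
  by exists 0; rewrite /collapse rmorph0 subrr mulr0.
have [t Et] : exists r, 'X_[m] - collapse i j 'X_[m] = ('X_i - 'X_j) * r.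
  rewrite mpolyXE_id; elim/big_ind: _ => // a _.
  elim: (m a) => [|e IHe]; first by rewrite expr0.
  rewrite exprS; apply: mulP => //; rewrite collapseX.
  case: eqP => [->|_]; first by exists 1; rewrite mulr1.
  by exists 0; rewrite subrr mulr0.
exists (c *: t + r); rewrite /collapse linearP /= -!/(collapse _ _ _).
by rewrite mulrDr -scalerAr -Et -Er scalerBr opprD addrACA.
Qed.

Fact mpolyX_neq i j : i != j -> ('X_i - 'X_j : {mpoly A[k]}) != 0.
Proof.
move=> ne; rewrite subr_eq0; apply: contra ne => /eqP /mpolyP /(_ U_(i)%MM).
rewrite !mcoeffXU eqxx eq_sym; case: eqP => // _ /eqP.
by rewrite oner_eq0.
Qed.

Fact vdm_neq0 : vdm != 0.
Proof.
apply/prodf_neq0 => i _; apply/prodf_neq0 => j ij.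
by apply: mpolyX_neq; rewrite -val_eqE neq_ltn ij.
Qed.

Fact dvd_pairs (s : seq ('I_k * 'I_k)) p : uniq s ->
    (forall c : 'I_k * 'I_k, c \in s -> (c.1 < c.2)%N) ->
    (forall c : 'I_k * 'I_k, c \in s -> collapse c.1 c.2 p = 0) ->
  exists r, p = r * \prod_(c <- s) ('X_c.1 - 'X_c.2).
Proof.
elim: s => [|[i j] s IHs] /=; first by exists p; rewrite big_nil mulr1.
case/andP=> ijs us lts ps.
have [||r Er] := IHs us.
- by move=> c cs; apply: lts; rewrite inE cs orbT.
- by move=> c cs; apply: ps; rewrite inE cs orbT.
have ltij : (i < j)%N by apply: (lts (i, j)); rewrite mem_head.
have r0 : collapse i j r = 0.
  have /eqP := ps (i, j) (mem_head _ _); rewrite {1}Er /collapse /= rmorphM /=.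
  rewrite mulf_eq0 => /orP[/eqP //|]; rewrite rmorph_prod /=.
  rewrite prodf_seq_eq0 => /hasP[[a b] abs] /=.
  rewrite rmorphB /= -!/(collapse _ _ _) !collapseX => ab0; exfalso; move: ab0.
  have ltab : (a < b)%N by apply: (lts (a, b)); rewrite inE abs orbT.
  apply/negP; have [ai|nai] := eqVneq a i.
    have nbi : (b == i) = false.
      by rewrite -val_eqE -ai; apply/negbTE; rewrite neq_ltn ltab orbT.
    rewrite nbi; apply: mpolyX_neq; apply: contraNN ijs => /eqP ->.
    by rewrite -ai.
  have [bi|nbi] := eqVneq b i; apply: mpolyX_neq; rewrite -val_eqE neq_ltn.
    by rewrite (ltn_trans ltab) // bi.
  by rewrite ltab.
have [t] := collapse_dvd i j r; rewrite r0 subr0 => Et.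
by exists t; rewrite big_cons /= Er Et mulrA [t * _]mulrC.
Qed.

Fact vdm_dvd_num l : exists p, p * vdm == fschur_num l.
Proof.
have vE : vdm = \prod_(c <- enum (fun c : 'I_k * 'I_k => (c.1 < c.2)%N))
    ('X_c.1 - 'X_c.2).
  by rewrite /vdm pair_big_dep big_enum.
have [|c|c|r Er] := @dvd_pairs (enum (fun c : 'I_k * 'I_k => (c.1 < c.2)%N))
    (fschur_num l).
- exact: enum_uniq.
- by rewrite mem_enum.
- rewrite mem_enum unfold_in => lt12; rewrite /collapse /fschur_num -det_tr.
  rewrite -det_map_mx; apply: (@determinant_alternate _ _ _ c.1 c.2).
    by rewrite -val_eqE neq_ltn lt12.
  move=> i; rewrite !mxE /fpow !rmorph_prod; apply: eq_bigr => a _ /=.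
  rewrite !rmorphB /= -!/(collapse _ _ _) !collapseX eqxx.
  by case: eqP => [<-|_].
by exists r; rewrite vE -Er.
Qed.

(* the exact quotient fschur_num / vdm, unique because vdm != 0 *)
Definition fschur l : {mpoly A[k]} := xchoose (vdm_dvd_num l).

Lemma fschurE l : fschur l * vdm = fschur_num l.
Proof. exact/eqP/(xchooseP (vdm_dvd_num l)). Qed.

Fact msymXU (s : 'S_k) i : msym s ('X_i : {mpoly A[k]}) = 'X_(s i).
Proof.
rewrite msymX; congr 'X_[_]; apply/mnmP => j; rewrite !mnmE.
by rewrite -(inj_eq (@perm_inj _ s)) permKV.
Qed.

Fact det_col_perm n (B : comNzRingType) (s : 'S_n) (M : 'M[B]_n) :
  \det (col_perm s M) = (-1) ^+ s * \det M.
Proof.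
by rewrite col_permE det_mulmx det_perm odd_permV mulrC.
Qed.

Fact msym_num (s : 'S_k) l : msym s (fschur_num l) = (-1) ^+ s * fschur_num l.
Proof.
rewrite /fschur_num -det_map_mx -det_col_perm; congr (\det _).
apply/matrixP => i j; rewrite !mxE /fpow rmorph_prod; apply: eq_bigr => a _ /=.
rewrite rmorphB /= msymXU; congr (_ - _).
  by rewrite -alg_mpolyC msymZ msym1.
Qed.

Fact msym_vdm (s : 'S_k) : msym s vdm = (-1) ^+ s * vdm.
Proof.
pose V := Vandermonde k (\row_j 'X_j : 'rV[{mpoly A[k]}]_k).
have -> : vdm = (\prod_(i < k) \prod_(j < k | (i < j)%N) (-1)) * \det V.
  rewrite det_Vandermonde -big_split; apply: eq_bigr => i _ /=.
  rewrite -big_split; apply: eq_bigr => j _ /=.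
  by rewrite !mxE mulN1r opprB.
rewrite rmorphM /= rmorph_prod mulrCA; congr (_ * _).
  apply: eq_bigr => i _; rewrite rmorph_prod; apply: eq_bigr => j _ /=.
  by rewrite rmorphN rmorph1.
rewrite -det_map_mx -det_col_perm; congr (\det _).
by apply/matrixP => i j; rewrite !mxE rmorphXn /= msymXU.
Qed.

Lemma fschur_sym l : fschur l \is symmetric.
Proof.
apply/issymP => s; apply: (mulIf vdm_neq0); rewrite fschurE.
apply: (can_inj (signrMK s)).
by rewrite mulrCA -msym_vdm -rmorphM /= fschurE msym_num.
Qed.

End FactorialSchur.

(* V = A^n. A tensor of V^(tensor k) is given by its coordinates on the basis
   v_(b 0) (x) ... (x) v_(b (k-1)), with b a function from 'I_k to 'I_n.
   The exterior power is the quotient by the submodule spanned by the elementary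
   tensors with two equal factors. Coordinates on the dual basis identify V^*
   with A^n as well, so ext also serves as the exterior power of V^*. *)
Section ExteriorPower.
Variables (n k : nat) (A : comNzRingType).

Definition tensor := {ffun {ffun 'I_k -> 'I_n} -> A^o}.

(* tensor product of the k columns of X *)
Definition elem_tensor (X : 'M[A]_(n, k)) : tensor :=
  [ffun b : {ffun 'I_k -> 'I_n} => \prod_(i < k) X (b i) i].

Definition repeated_col : pred 'M[A]_(n, k) :=
  fun X => [exists i, exists j, (i != j) && (col i X == col j X)].

Definition alt_tensor : {pred tensor} :=
  fun t => `[< exists2 s : seq (A * 'M[A]_(n, k)),
    all (fun c => repeated_col c.2) s
    & t = \sum_(c <- s) c.1 *: elem_tensor c.2 >].

Fact alt_tensor_submod : submod_closed alt_tensor.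
Proof.
split; first by apply/asboolP; exists [::]; rewrite ?big_nil.
move=> a t t' /asboolP[s sP ->] /asboolP[s' sP' ->]; apply/asboolP.
exists ([seq (a * c.1, c.2) | c <- s] ++ s').
  by rewrite all_cat sP' andbT all_map.
rewrite big_cat big_map scaler_sumr; congr (_ + _).
by apply: eq_bigr => c _; rewrite scalerA.
Qed.

Definition ext := quotmod alt_tensor_submod.
HB.instance Definition _ :
  EqQuotient tensor (Quotient.equiv (submod alt_tensor_submod)) ext :=
  EqQuotient.on ext.
HB.instance Definition _ := Choice.on ext.
HB.instance Definition _ := ZmodQuotient.on ext.
HB.instance Definition _ := GRing.Lmodule.on ext.

Definition wedge (X : 'M[A]_(n, k)) : ext := \pi_ext (elem_tensor X).

(* The pairing of v^(a 0) (x) ... (x) v^(a (k-1)) and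
   v_(b 0) (x) ... (x) v_(b (k-1)) is det (delta_(a i, b j)). *)
Definition tensor_pairing (s t : tensor) : A :=
  \sum_a \sum_b s a * t b * \det (\matrix_(i < k, j < k) (a i == b j)%:R).

(* the induced pairing of the exterior powers of V^* (first argument) and V; it is
   well defined by ext_pairing_pi, and ext_pairing_wedge computes it *)
Definition ext_pairing : ext -> ext -> A := lift_fun2 ext tensor_pairing.

(* M acting on the i-th tensor factor *)
Definition tensor_factor (M : 'M[A]_n) (i : 'I_k) (t : tensor) : tensor :=
  [ffun b : {ffun 'I_k -> 'I_n} =>
     \sum_(c < n) M (b i) c * t [ffun l => if l == i then c else b l]].

Definition tensor_mon (M : 'M[A]_n) (m : 'X_{1..k}) : tensor -> tensor :=
  \big[comp/id]_(i < k) iter (m i) (tensor_factor M i).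

(* p(M_1, ..., M_k), where M_i is tensor_factor M i *)
Definition tensor_act (M : 'M[A]_n) (p : {mpoly A[k]}) (t : tensor) : tensor :=
  \sum_(m <- msupp p) p@_m *: tensor_mon M m t.

(* the operator induced on the exterior power, well defined by ext_act_pi *)
Definition ext_act (M : 'M[A]_n) (p : sympoly k A) : ext -> ext :=
  lift_op1 ext (tensor_act M p).

Lemma elem_tensor_pairing a X :
  \sum_b elem_tensor X b * \det (\matrix_(i < k, j < k) (a i == b j)%:R) =
  \det (\matrix_(i < k, j < k) X (a i) j).
Proof.
under eq_bigr do rewrite mulr_sumr; rewrite exchange_big /=.
apply: eq_bigr => s _; under eq_bigr do rewrite mulrCA.
rewrite -mulr_sumr; congr (_ * _).
transitivity (\sum_(b : {ffun 'I_k -> 'I_n})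
    \prod_j (X (b j) j * (a (s^-1%g j) == b j)%:R)).
  apply: eq_bigr => b _; rewrite ffunE big_split /=; congr (_ * _).
  rewrite [RHS](reindex_inj (@perm_inj _ s)) /=.
  by apply: eq_bigr => i _; rewrite mxE permK.
rewrite -(bigA_distr_bigA (fun j c => X c j * (a (s^-1%g j) == c)%:R)) /=.
rewrite (reindex_inj (@perm_inj _ s)) /=; apply: eq_bigr => i _.
rewrite mxE permK (bigD1 (a i)) //= eqxx mulr1 big1 ?addr0 // => c ne.
by rewrite eq_sym (negbTE ne) mulr0.
Qed.

Lemma tensor_pairingC s t : tensor_pairing s t = tensor_pairing t s.
Proof.
rewrite /tensor_pairing exchange_big; apply: eq_bigr => b _.
apply: eq_bigr => a _; rewrite [s a * _]mulrC; congr (_ * _).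
rewrite -det_tr; congr (\det _); apply/matrixP => i j.
by rewrite !mxE eq_sym.
Qed.

Lemma tensor_pairingDr s t t' :
  tensor_pairing s (t + t') = tensor_pairing s t + tensor_pairing s t'.
Proof.
rewrite /tensor_pairing -big_split; apply: eq_bigr => a _ /=.
rewrite -big_split; apply: eq_bigr => b _ /=.
by rewrite !ffunE mulrDr mulrDl.
Qed.

Lemma tensor_pairingZr c s t :
  tensor_pairing s (c *: t) = c * tensor_pairing s t.
Proof.
rewrite /tensor_pairing mulr_sumr; apply: eq_bigr => a _ /=.
rewrite mulr_sumr; apply: eq_bigr => b _ /=.
by rewrite !ffunE mulrCA !mulrA.
Qed.

Lemma tensor_pairing_alt s t : t \in alt_tensor -> tensor_pairing s t = 0.
Proof.
move=> /asboolP[r rP ->].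
elim: r rP => [_|[c X] r IHr /= /andP[/existsP[i /existsP[j /andP[ij /eqP Xij]]] rP]].
  rewrite big_nil -(scale0r s) tensor_pairingZr mul0r //.
rewrite big_cons tensor_pairingDr IHr // addr0 tensor_pairingZr /=.
rewrite /tensor_pairing big1 ?mulr0 // => a _.
under eq_bigr do rewrite -mulrA; rewrite -mulr_sumr elem_tensor_pairing.
rewrite -det_tr (determinant_alternate ij) ?mulr0 // => l; rewrite !mxE.
by have := congr1 (fun u : 'cV_n => u (a l) 0) Xij; rewrite !mxE.
Qed.

Lemma ext_pairing_pi s t :
  ext_pairing (\pi_ext s) (\pi_ext t) = tensor_pairing s t.
Proof.
unlock ext_pairing.
have repl s' u u' : u - u' \in alt_tensor ->
    tensor_pairing s' u = tensor_pairing s' u'.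
  by move=> uu; rewrite -[u](subrK u') tensor_pairingDr tensor_pairing_alt // add0r.
rewrite (repl _ (repr _) t (quotmod_reprP _ _)) tensor_pairingC.
by rewrite (repl _ (repr _) s (quotmod_reprP _ _)) tensor_pairingC.
Qed.

Lemma ext_pairing_wedge X Y :
  ext_pairing (wedge X) (wedge Y) = \det (X^T *m Y).
Proof.
rewrite ext_pairing_pi /tensor_pairing.
under eq_bigr do [under eq_bigr do rewrite -mulrA; rewrite -mulr_sumr elem_tensor_pairing].
under eq_bigr do rewrite mulr_sumr.
rewrite exchange_big; apply: eq_bigr => s _ /=.
under eq_bigr do rewrite mulrCA; rewrite -mulr_sumr; congr (_ * _).
transitivity (\sum_(b : {ffun 'I_k -> 'I_n})
    \prod_i (X (b i) i * Y (b i) (s i))).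
  apply: eq_bigr => b _; rewrite ffunE -big_split /=.
  by apply: eq_bigr => i _; rewrite mxE.
rewrite -(bigA_distr_bigA (fun i c => X c i * Y c (s i))) /=.
by apply: eq_bigr => i _; rewrite mxE; apply: eq_bigr => c _; rewrite mxE.
Qed.

Implicit Types (M : 'M[A]_n) (X : 'M[A]_(n, k)) (i j : 'I_k).

Lemma tensor_factor_linear M i a t t' :
  tensor_factor M i (a *: t + t') = a *: tensor_factor M i t + tensor_factor M i t'.
Proof.
apply/ffunP => b; rewrite !ffunE scaler_sumr -big_split; apply: eq_bigr => c _ /=.
by rewrite !ffunE mulrDr scalerAr.
Qed.

Lemma tensor_mon_linear M m a t t' :
  tensor_mon M m (a *: t + t') = a *: tensor_mon M m t + tensor_mon M m t'.
Proof.
rewrite /tensor_mon; elim/big_rec: _ a t t' => // i f _ IHf a t t' /=.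
rewrite {}IHf; elim: (m i) => // e IHe.
by rewrite iterS IHe tensor_factor_linear.
Qed.

Lemma tensor_act_linear M p a t t' :
  tensor_act M p (a *: t + t') = a *: tensor_act M p t + tensor_act M p t'.
Proof.
rewrite /tensor_act scaler_sumr -big_split; apply: eq_bigr => m _ /=.
by rewrite tensor_mon_linear scalerDr !scalerA mulrC.
Qed.

Lemma tensor_factor_elem M i X :
  tensor_factor M i (elem_tensor X) =
  elem_tensor (\matrix_(a, l) if l == i then (M *m X) a l else X a l).
Proof.
apply/ffunP => b; rewrite !ffunE (bigD1 i) //= !mxE eqxx mulr_suml.
apply: eq_bigr => c _; rewrite !ffunE (bigD1 i) //= !ffunE eqxx mulrA.
congr (_ * _); apply: eq_bigr => l /negbTE li.
by rewrite !ffunE !mxE li.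
Qed.

Definition mon_mx M X (m : 'X_{1..k}) : 'M[A]_(n, k) :=
  \matrix_(a, l) iter (m l) (mulmx M) (col l X) a 0.

Lemma tensor_mon_elem M m X :
  tensor_mon M m (elem_tensor X) = elem_tensor (mon_mx M X m).
Proof.
have itE i e Y : iter e (tensor_factor M i) (elem_tensor Y) =
    elem_tensor (\matrix_(a, l) if l == i then iter e (mulmx M) (col l Y) a 0
                                else Y a l).
  elim: e => [|e IHe] /=.
    by congr elem_tensor; apply/matrixP => a l; rewrite !mxE if_same.
  rewrite IHe tensor_factor_elem; congr elem_tensor; apply/matrixP => a l.
  rewrite !mxE; case: eqP => // ->; apply: eq_bigr => c _.
  by rewrite !mxE eqxx.
rewrite /tensor_mon.
have -> : mon_mx M X m = \matrix_(a, l)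
    if l \in index_enum 'I_k then iter (m l) (mulmx M) (col l X) a 0 else X a l.
  by apply/matrixP => a l; rewrite !mxE mem_index_enum.
elim: (index_enum _) (index_enum_uniq 'I_k) => [_|i r IHr /= /andP[ir /IHr{}IHr]].
  by rewrite big_nil; congr elem_tensor; apply/matrixP => a l; rewrite !mxE.
rewrite big_cons /= IHr itE; congr elem_tensor; apply/matrixP => a l.
rewrite !mxE inE; case: (eqVneq l i) => //= ->.
set c1 := col _ _; suff -> : c1 = col i X by []. apply/matrixP => c d.
by rewrite !mxE (negbTE ir).
Qed.

Lemma elem_tensor_alt X i j : i != j -> col i X = col j X ->
  elem_tensor X \in alt_tensor.
Proof.
move=> ij Xij; apply/asboolP; exists [:: (1, X)].
  rewrite /= andbT; apply/existsP; exists i; apply/existsP; exists j.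
  by rewrite ij Xij eqxx.
by rewrite big_seq1 scale1r.
Qed.

Lemma elem_tensor_swap X i j : i != j ->
  elem_tensor X + elem_tensor (xcol i j X) \in alt_tensor.
Proof.
move=> ij; pose Y (u v : 'cV[A]_n) := \matrix_(a, l)
  (if l == i then u a 0 else if l == j then v a 0 else X a l).
have eY u v b : elem_tensor (Y u v) b =
    u (b i) 0 * (v (b j) 0 * \prod_(l < k | (l != i) && (l != j)) X (b l) l).
  rewrite ffunE (bigD1 i) //= (bigD1 j) 1?eq_sym //= !mxE !eqxx.
  rewrite eq_sym (negbTE ij); congr (_ * (_ * _)); apply: eq_bigr => l.
  by case/andP=> /negbTE li /negbTE lj; rewrite mxE li lj.
pose u := col i X; pose v := col j X.
have -> : elem_tensor X = elem_tensor (Y u v).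
  congr elem_tensor; apply/matrixP => a l; rewrite !mxE.
  by case: eqP => [->|_] //; case: eqP => [->|].
have -> : elem_tensor (xcol i j X) = elem_tensor (Y v u).
  congr elem_tensor; apply/matrixP => a l; rewrite !mxE.
  by case: tpermP => [->|->|/eqP/negbTE-> /eqP/negbTE->];
    rewrite ?eqxx // eq_sym (negbTE ij).
have altY w : elem_tensor (Y w w) \in alt_tensor.
  apply: (elem_tensor_alt ij); apply/matrixP => a l.
  by rewrite !mxE !eqxx; case: eqP.
have -> : elem_tensor (Y u v) + elem_tensor (Y v u) =
    elem_tensor (Y (u + v) (u + v)) - elem_tensor (Y u u) - elem_tensor (Y v v).
  apply/ffunP => b; rewrite ffunE [in RHS]ffunE [in RHS]ffunE.
  have oppE (t : tensor) : (- t) b = - t b by rewrite ffunE.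
  rewrite !oppE !eY !mxE; set a := X _ _; set c := X _ _; set d := \prod_(_ | _) _.
  rewrite !mulrDl !mulrDr; set x := a * (X _ _ * _); set z := X _ _ * (X _ _ * _).
  by rewrite [in RHS]addrA [RHS]addrAC addrK -[X in X - _]addrA [X in X - _]addrC addrK.
have altB : {in alt_tensor &, forall t t', t - t' \in alt_tensor}.
  exact: (@rpredB _ (submod alt_tensor_submod)).
by rewrite !altB ?altY.
Qed.

Lemma tensor_act_alt M (p : sympoly k A) t :
  t \in alt_tensor -> tensor_act M p t \in alt_tensor.
Proof.
move=> /asboolP[s sP ->].
have rD : {in alt_tensor &, forall u v, u + v \in alt_tensor}.
  exact: (@rpredD _ (submod alt_tensor_submod)).
have rS (I : eqType) (r : seq I) (P : pred I) (F : I -> tensor) :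
  (forall x, P x -> F x \in alt_tensor) ->
    \sum_(x <- r | P x) F x \in alt_tensor.
  exact: (@rpred_sum _ (submod alt_tensor_submod)).
have rZ a u : u \in alt_tensor -> a *: u \in alt_tensor.
  exact: (@rpredZ _ _ (submod alt_tensor_submod)).
have act0 : tensor_act M p 0 = 0.
  have := tensor_act_linear M p (-1) 0 0.
  by rewrite scaler0 addr0 scaleN1r addNr.
elim: s sP => [_|[c X] s IHs /= /andP[]].
  by rewrite big_nil act0; apply/asboolP; exists [::]; rewrite ?big_nil.
move=> /existsP[i /existsP[j /andP[ij /eqP Xij]]] sP.
rewrite big_cons tensor_act_linear rD ?IHs // rZ //.
rewrite /tensor_act /=; under eq_bigr do rewrite tensor_mon_elem.
pose sw (m : 'X_{1..k}) := [multinom m (tperm i j l) | l < k].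
have swK : involutive sw by move=> m; apply/mnmP => l; rewrite !mnmE tpermK.
have swc m : (val p)@_(sw m) = (val p)@_m by apply: msym_coeff; exact: valP p.
have swX m : mon_mx M X (sw m) = xcol i j (mon_mx M X m).
  apply/matrixP => a l; rewrite !mxE mnmE.
  suff -> : col l X = col (tperm i j l) X by [].
  by case: tpermP => [->|->|].
rewrite (bigID (fun m : 'X_{1..k} => m i == m j)) /= rD //.
  apply: rS => m /eqP mij; apply/rZ/(elem_tensor_alt ij); apply/matrixP => a b.
  by rewrite !mxE mij Xij.
rewrite (bigID (fun m : 'X_{1..k} => (m i < m j)%N)) /=.
have sup : perm_eq (msupp (val p)) [seq sw m | m <- msupp (val p)].
  apply: uniq_perm; rewrite ?(map_inj_uniq (inv_inj swK)) ?msupp_uniq // => m.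
  apply/idP/mapP => [mp|[m' mp' ->]].
    by exists (sw m); rewrite ?swK // mcoeff_msupp swc -mcoeff_msupp.
  by rewrite mcoeff_msupp swc -mcoeff_msupp.
rewrite [X in _ + X](perm_big _ sup) /= big_map /=.
rewrite [X in _ + X](eq_bigl
    (fun m : 'X_{1..k} => (m i != m j) && (m i < m j)%N)); last first.
  move=> m; rewrite !mnmE tpermL tpermR eq_sym -leqNgt leq_eqVlt.
  by case: eqP.
rewrite -big_split /=; apply: rS => m _.
by rewrite swc swX -scalerDr; apply/rZ/elem_tensor_swap.
Qed.

Lemma ext_act_pi M (p : sympoly k A) t :
  ext_act M p (\pi_ext t) = \pi_ext (tensor_act M p t).
Proof.
unlock ext_act; apply/quotmod_eqP.
have -> u v : tensor_act M p u - tensor_act M p v = tensor_act M p (u - v).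
  by rewrite addrC -scaleN1r -tensor_act_linear scaleN1r addrC.
exact/tensor_act_alt/quotmod_reprP.
Qed.
End ExteriorPower.

Section Grassmannian.
Variables (k n : nat).

Definition is_grass (w : 'S_n) : bool :=
  [forall i : 'I_n, forall j : 'I_n,
    (i < j)%N && ((j < k)%N || (k <= i)%N) ==> (w i < w j)%N].

Definition grass := {w : 'S_n | is_grass w}.
HB.instance Definition _ := SubFinite.on grass.

Hypothesis kn : (k <= n)%N.

(* With indices starting from 0: the permutation at position p < k takes the
   value lambda_(k-1-p) + p. *)
Definition grass_part (w : grass) (i : 'I_k) : nat :=
  (val w (widen_ord kn (rev_ord i)) - rev_ord i)%N.
End Grassmannian.

Section QuantumCohomology.
Variables (k n : nat) (kn : (k <= n)%N).
Variables (A : idomainType) (y : nat -> A) (q : A).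

Definition fschur_sp (l : 'I_k -> nat) : sympoly k A :=
  SymPoly (fschur_sym y l).

Definition hsym (r : nat) : sympoly k A :=
  fschur_sp (fun i => if i == 0%N :> nat then r else 0%N).

(* h_(n-k+1), ..., h_(n-1), h_n + (-1)^k q *)
Definition qH_rel (i : 'I_k) : sympoly k A :=
  let r := (n - k + i.+1)%N in
  if r == n then hsym n + ((-1) ^+ k * q)%:A else hsym r.

Definition qH := quotalg qH_rel.
HB.instance Definition _ :
  EqQuotient (sympoly k A)
    (Quotient.equiv (submod (gen_ideal_submod qH_rel))) qH :=
  EqQuotient.on qH.
HB.instance Definition _ := Choice.on qH.
HB.instance Definition _ := ZmodQuotient.on qH.
HB.instance Definition _ := GRing.Lmodule.on qH.
HB.instance Definition _ := GRing.ComPzRing.on qH.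

Definition schubert (w : grass k n) : sympoly k A := fschur_sp (grass_part kn w).

Definition schubert_class (w : grass k n) : qH := \pi_qH (schubert w).

Definition schubert_expansion (u v : grass k n) : set {ffun grass k n -> A} :=
  [set c | schubert_class u * schubert_class v =
           \sum_(w : grass k n) c w *: schubert_class w].

(* the coefficient of schubert_class w; the Schubert classes form an A-basis of qH,
   so that the expansion exists and is unique *)
Definition gw (u v w : grass k n) : A := xget 0 (schubert_expansion u v) w.

(* E_(i,j) has its entry 1 in row i and column j, and acts on column vectors. *)
Definition quantised_chern_root : 'M[A]_n :=
  \matrix_(i, j)
    (((-1) ^+ k.-1 * q) *+ ((i == 0%N :> nat) && (j == n.-1 :> nat))
     + (i == j.+1 :> nat)%:R + y i *+ (i == j)).

(* |w>, and also <w| when read in coordinates on the dual basis *)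
Definition grass_wedge (w : grass k n) : ext n k A :=
  wedge (\matrix_(a < n, j < k) (a == val w (widen_ord kn j))%:R).
End QuantumCohomology.

(* Z[y_1, ..., y_n][q, q^-1], with y_j = 0 for j > n; y_j is Rq_y n j.-1 *)
Definition Rq (n : nat) : idomainType := laurent {mpoly int[n]}.
Definition Rq_y (n : nat) (j : nat) : Rq n :=
  if insub j is Some i then laurentC 'X_(i : 'I_n) else 0.
Definition Rq_q (n : nat) : Rq n := laurent_q _.

(* Main.v *)
Require Import Defs.
From mathcomp Require Import all_boot perm all_algebra.
From HB Require Import structures.
From mathcomp.multinomials Require Import ssrcomplements mpoly.
From mathcomp Require Import boolp.
From mathcomp Require classical_sets.

(**
Write A for the coefficient ring, S for the symmetric polynomials in x_1, ...,
x_k over A, (t|y)^d for the product of t - y_1, ..., t - y_d, and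
f = (t|y)^n + (-1)^k q.  The quantised Chern root M has f as characteristic
polynomial and v_1 as cyclic vector: M sends v_d to v_(d+1) + y_d v_d for d < n,
so that v_d = (M|y)^(d-1) v_1 and f(M) v_1 = 0 ([polyact_facpow],
[polyact_qcharpoly]).  Hence V is A[t]/(f), its k-th tensor power is
A[x_1, ..., x_k]/(f(x_1), ..., f(x_k)) with p(X_1^q, ..., X_k^q) acting as
multiplication by p, and exterior powers are handled by antisymmetrising.

For polynomials p_1, ..., p_k in one variable put [p_1, ..., p_k] =
det (p_i(x_j)).  The bialternant formula says that s_lambda(w) times the
Vandermonde product is, up to the sign of the order-reversing permutation,
[(t|y)^(w_1 - 1), ..., (t|y)^(w_k - 1)].  Let T_w(g), written [amplitude w g],
be the coefficient of v_(w_1) (x) ... (x) v_(w_k) in g applied to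
v_1 (x) ... (x) v_1.  Three facts give the theorem.

- The matrix element <w| p |v> is T_w (p [(t|y)^(v_i - 1)]): the determinant in
  the pairing antisymmetrises over the permutations of w, and since p is
  symmetric the antisymmetrisation moves onto the polynomial that creates |v>
  ([pairing_amplitude]).  In particular T_w takes the value 1 or 0 on
  [(t|y)^(x_i - 1)] according as x = w or not ([amplitude_word]).

- T_w vanishes on the product of the Vandermonde with the defining ideal of the
  quantum cohomology ring ([amplitude_ideal]).  The i-th relation times the
  Vandermonde is [f t^i, (t|y)^(k-2), ..., 1], because y_j = 0 for j > n
  makes (t|y)^(n+i) equal to (t|y)^n t^i; each term of its expansion along the
  first row is divisible by some f(x_j).

- Every symmetric polynomial is an A-combination of Schubert polynomials modulo
  that ideal ([schubert_span]), so that the expansion which defines the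
  invariants exists.

Expanding the product of the classes of u and v, multiplying by the Vandermonde
and applying T_w then isolates the coefficient of the class of w and shows that
it is <w| s_u |v>.  The same computation makes the expansion unique.

For the spanning statement, let E be the polynomial with roots x_1, ..., x_k;
its coefficients lie in S. Evaluation at the x_j only sees residues modulo E,
so [p_1, ..., p_k] is the Vandermonde times the determinant in S of the
coefficients of the p_i mod E ([alternant_res]). The relations are the top
coefficients of f t^i mod E, and these generate all the coefficients of f p
mod E ([top_coefs_ideal], [res_qcharpoly_ideal]). Modulo the ideal one may
therefore replace every p_i by its remainder by f, of degree less than n, and
expand it in the (t|y)^d with d < n.
*)

Set Implicit Arguments.
Unset Strict Implicit.
Unset Printing Implicit Defensive.

Import GRing.Theory.
Import Pdiv.CommonRing Pdiv.RingMonic.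
Local Open Scope ring_scope.
Local Open Scope quotient_scope.

(** * Alternants and factorial powers *)

Section Alternant.
Variables (k : nat) (A : idomainType).
Local Notation S := (sympoly k A).
Implicit Types (i j l : 'I_k) (p : {poly A}) (P Q : {poly S}).

Definition xeval j P : {mpoly A[k]} := (map_poly val P).['X_j].

Lemma xeval_is_zmod_morphism j : zmod_morphism (xeval j).
Proof. by move=> P Q; rewrite /xeval rmorphB hornerD hornerN. Qed.
Lemma xeval_is_monoid_morphism j : monoid_morphism (xeval j).
Proof.
by split=> [|P Q]; rewrite /xeval ?rmorph1 ?hornerC // rmorphM hornerM.
Qed.
HB.instance Definition _ j :=
  GRing.isZmodMorphism.Build {poly S} {mpoly A[k]} (xeval j)
    (xeval_is_zmod_morphism j).
HB.instance Definition _ j :=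
  GRing.isMonoidMorphism.Build {poly S} {mpoly A[k]} (xeval j)
    (xeval_is_monoid_morphism j).

Lemma xevalC j (c : S) : xeval j c%:P = val c.
Proof. by rewrite /xeval map_polyC hornerC. Qed.
Lemma xevalX j : xeval j 'X = 'X_j.
Proof. by rewrite /xeval map_polyX hornerX. Qed.
Lemma xevalE j P d : (size P <= d)%N ->
  xeval j P = \sum_(i < d) val P`_i * 'X_j ^+ i.
Proof.
move=> Pd; rewrite /xeval (horner_coef_wide _ (n := d)).
  by apply: eq_bigr => i _; rewrite coef_map.
exact: leq_trans (size_poly _ _) Pd.
Qed.

Definition alternant (F : 'I_k -> {poly S}) : {mpoly A[k]} :=
  \det (\matrix_(i, j) xeval j (F i)).

Lemma eq_alternant (F G : 'I_k -> {poly S}) :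
  F =1 G -> alternant F = alternant G.
Proof.
by move=> E; congr (\det _); apply/matrixP => i j; rewrite !mxE E.
Qed.

Lemma alternant_perm (F : 'I_k -> {poly S}) (s : 'S_k) :
  alternant (F \o s) = (-1) ^+ s * alternant F.
Proof.
rewrite /alternant -[in LHS]det_tr -[in RHS]det_tr -det_col_perm.
by congr (\det _); apply/matrixP => i j; rewrite !mxE.
Qed.

(** [det_Vandermonde] has increasing powers and factors x_j - x_i with i < j;
    reversing both rows and columns leaves the determinant unchanged and turns
    these factors into x_i - x_j. *)
Lemma vdm_det : vdm k A = \det (\matrix_(i, j) 'X_j ^+ (k - i.+1)).
Proof.
pose r := perm (@rev_ord_inj k).
have rE i : r i = rev_ord i by rewrite permE.
pose a : 'rV[{mpoly A[k]}]_k := \row_j 'X_(rev_ord j).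
transitivity (\det (Vandermonde k a)).
  rewrite det_Vandermonde /vdm.
  rewrite (pair_big_dep xpredT (fun i j : 'I_k => i < j)%N
             (fun i j => 'X_i - 'X_j)).
  rewrite (pair_big_dep xpredT (fun i j : 'I_k => i < j)%N
             (fun i j => a 0 j - a 0 i)) /=.
  pose h (c : 'I_k * 'I_k) := (rev_ord c.2, rev_ord c.1).
  rewrite (reindex_inj (h := h)) /=.
    apply: eq_big => [[i j]|[i j] _] /=; last by rewrite !mxE.
    by rewrite ltn_sub2lE.
  move=> [i j] [i' j'] E; have := congr1 snd E; have := congr1 fst E.
  by move=> /rev_ord_inj /= -> /rev_ord_inj /= ->.
transitivity (\det (col_perm r (row_perm r (\matrix_(i < k, j < k)
    ('X_j : {mpoly A[k]}) ^+ (k - i.+1))))).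
  congr (\det _); apply/matrixP => i j; rewrite !mxE !rE /=.
  by rewrite subnSK // subKn // ltnW.
rewrite det_col_perm -det_tr tr_row_perm det_col_perm det_tr mulrA -expr2.
by rewrite sqrr_sign mul1r.
Qed.

(** Columns are ordered by decreasing degree, to match the exponents in
    [vdm_det]. *)
Definition coords (F : 'I_k -> {poly S}) : 'M[S]_k :=
  \matrix_(i, l) (F i)`_(k - l.+1).

(** The matrix of values factors as the matrix of coefficients times the
    Vandermonde matrix. *)
Lemma alternant_lowdeg (F : 'I_k -> {poly S}) : (forall i, size (F i) <= k)%N ->
  alternant F = val (\det (coords F)) * vdm k A.
Proof.
move=> Fk; rewrite -[val _](det_map_mx (val : {rmorphism S -> {mpoly A[k]}})).
rewrite vdm_det -det_mulmx; congr (\det _); apply/matrixP => i j; rewrite !mxE.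
rewrite (xevalE _ (Fk i)) (reindex_inj rev_ord_inj) /=.
by apply: eq_bigr => l _; rewrite !mxE.
Qed.

Lemma alternant_triangular (F : 'I_k -> {poly S}) :
    (forall i, size (F i) <= k - i)%N ->
  alternant F = val (\prod_i (F i)`_(k - i.+1)) *
                vdm k A.
Proof.
move=> Fk; rewrite alternant_lowdeg => [|i]; last first.
  exact: leq_trans (leq_subr _ _).
rewrite -det_tr det_trig; last first.
  apply/is_trig_mxP => i j ij; rewrite !mxE nth_default //.
  by rewrite (leq_trans (Fk j)) // leq_sub2l.
by congr (val _ * _); apply: eq_bigr => i _; rewrite !mxE.
Qed.



Definition spoly : {poly A} -> {poly S} := map_poly (in_alg S).
HB.instance Definition _ := GRing.RMorphism.on spoly.

Lemma val_alg (a : A) : val (a%:A : S) = a%:MP.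
Proof.
rewrite -alg_mpolyC.
by rewrite -[1 in RHS](rmorph1 (val : {rmorphism S -> {mpoly A[k]}})) -linearZ.
Qed.

Lemma size_spoly p : size (spoly p) = size p.
Proof.
apply: size_map_inj_poly => [a b /(congr1 val)|]; last by rewrite rmorph0.
by rewrite !val_alg => /eqP; rewrite mpolyC_eq => /eqP.
Qed.

Lemma coef_spoly p d : (spoly p)`_d = (p`_d)%:A.
Proof. exact: coef_map. Qed.

Lemma xeval_spoly_coef j p d : (size p <= d)%N ->
  xeval j (spoly p) = \sum_(i < d) p`_i *: 'X_j ^+ i.
Proof.
move=> pd; rewrite (xevalE _ (d := d)) ?size_spoly //.
by apply: eq_bigr => i _; rewrite coef_spoly val_alg mul_mpolyC.
Qed.

Lemma spolyC a : spoly a%:P = (a%:A)%:P.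
Proof. exact: map_polyC. Qed.

Lemma spolyXn d : spoly ('X^d : {poly A}) = 'X^d.
Proof. exact: map_polyXn. Qed.

Lemma xeval_spolyM j p1 p2 :
  xeval j (spoly (p1 * p2)) = xeval j (spoly p1) * xeval j (spoly p2).
Proof. by rewrite !rmorphM. Qed.

Lemma xeval_spolyXn j d : xeval j (spoly ('X^d : {poly A})) = 'X_j ^+ d.
Proof. by rewrite spolyXn rmorphXn /= xevalX. Qed.

Variable y : nat -> A.

(** The factorial power (t|y)^d as a polynomial in one variable t. *)
Definition facpow d : {poly A} := \prod_(a < d) ('X - (y a)%:P).

Lemma size_facpow d : size (facpow d) = d.+1.
Proof.
by rewrite size_prod_XsubC [index_enum _]unlock -enumT size_enum_ord.
Qed.
Lemma monic_facpow d : facpow d \is monic.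
Proof. exact: monic_prod_XsubC. Qed.
Lemma facpowS d : facpow d.+1 = facpow d * ('X - (y d)%:P).
Proof. by rewrite /facpow big_ord_recr. Qed.

Lemma xeval_facpow j d : xeval j (spoly (facpow d)) = fpow y j d.
Proof.
rewrite !rmorph_prod; apply: eq_bigr => a _ /=; rewrite !rmorphB /=.
rewrite /spoly map_polyX xevalX map_polyC xevalC.
by congr (_ - _); apply: val_alg.
Qed.

Lemma fschur_num_alternant (l : 'I_k -> nat) :
  fschur_num y l = alternant (fun i => spoly (facpow (l i + (k - i.+1)))).
Proof.
by congr (\det _); apply/matrixP => i j; rewrite !mxE xeval_facpow.
Qed.

End Alternant.

(** * Reduction modulo the polynomial with roots x_1, ..., x_k *)

Lemma horner_prod_XsubC (B : comNzRingType) (I : finType) (x : I -> B) j :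
  (\prod_i ('X - (x i)%:P)).[x j] = 0.
Proof. by rewrite horner_prod (bigD1 j) //= hornerXsubC subrr mul0r. Qed.

Section RootPoly.
Variables (k : nat) (A : idomainType).
Local Notation S := (sympoly k A).
Implicit Types (i j l : 'I_k) (p : {poly A}) (P Q : {poly S}).

(** The monic polynomial with roots x_1, ..., x_k; rootpoly is the same
    polynomial with its coefficients regarded as symmetric polynomials. *)
Definition xprod : {poly {mpoly A[k]}} := \prod_(j < k) ('X - ('X_j)%:P).

Lemma xprod_coef_sym d : xprod`_d \is symmetric.
Proof.
apply/issymP => s; rewrite -[LHS]coef_map; congr (polyseq _)`_d.
rewrite rmorph_prod; rewrite [RHS](reindex_inj (@perm_inj _ s)) /=.
by apply: eq_bigr => j _; rewrite rmorphB /= map_polyX map_polyC /= msymXU.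
Qed.

Definition rootpoly : {poly S} := \poly_(d < k.+1) SymPoly (xprod_coef_sym d).

Lemma size_xprod : size xprod = k.+1.
Proof.
by rewrite size_prod_XsubC [index_enum _]unlock -enumT size_enum_ord.
Qed.

Lemma map_rootpoly : map_poly val rootpoly = xprod.
Proof.
apply/polyP => d; rewrite coef_map coef_poly; case: ltnP => // kd.
by rewrite [RHS]nth_default ?size_xprod.
Qed.

Lemma size_rootpoly : size rootpoly = k.+1.
Proof.
rewrite -size_xprod -map_rootpoly.
by apply/esym/size_map_inj_poly; [exact: val_inj | exact: rmorph0].
Qed.

Lemma monic_rootpoly : rootpoly \is monic.
Proof.
apply/monicP/val_inj; rewrite lead_coefE size_rootpoly rmorph1.
rewrite -[LHS]coef_map map_rootpoly.
have /monicP := monic_prod_XsubC (index_enum 'I_k) xpredT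
  (fun j => 'X_j : {mpoly A[k]}).
by rewrite lead_coefE size_xprod.
Qed.

Lemma xeval_rootpoly j : xeval j rootpoly = 0.
Proof.
by rewrite /xeval map_rootpoly (horner_prod_XsubC (fun i => 'X_i)).
Qed.

Local Notation res P := (rmodp P rootpoly).

Lemma size_res P : (size (res P) <= k)%N.
Proof.
by rewrite -ltnS -size_rootpoly ltn_rmodp monic_neq0 // monic_rootpoly.
Qed.

Lemma res_small P : (size P <= k)%N -> res P = P.
Proof. by move=> Pk; rewrite rmodp_small // size_rootpoly. Qed.

Lemma xeval_res j P : xeval j (res P) = xeval j P.
Proof.
rewrite [in RHS](rdivp_eq monic_rootpoly P) rmorphD rmorphM /=.
by rewrite xeval_rootpoly mulr0 add0r.
Qed.

(** Values at the roots x_j depend only on residues, and residues have degree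
    less than k. This turns questions on alternants, which live in A[x_1, ...,
    x_k], into questions on a determinant over the symmetric polynomials. *)
Lemma alternant_res (F : 'I_k -> {poly S}) :
  alternant F = val (\det (coords (fun i => res (F i)))) * vdm k A.
Proof.
rewrite -alternant_lowdeg => [|i]; last exact: size_res.
by congr (\det _); apply/matrixP => i j; rewrite !mxE xeval_res.
Qed.

Lemma res_mulX P : (0 < k)%N -> (size P <= k)%N ->
  res (P * 'X) = P * 'X - P`_k.-1 *: rootpoly.
Proof.
move=> k0 Pk; have mE := monic_rootpoly.
rewrite -[in LHS](subrK (P`_k.-1 *: rootpoly) (P * 'X)) addrC.
rewrite -[X in X + _]mul_polyC rmodp_addl_mul_small // size_rootpoly ltnS.
apply/leq_sizeP => d; rewrite leq_eqVlt coefB coefZ coefMX.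
case/orP => [/eqP <-|kd].
  have -> : rootpoly`_k = 1.
    by move/monicP: mE; rewrite lead_coefE size_rootpoly.
  by rewrite mulr1 gtn_eqF // subrr.
rewrite (nth_default 0 (_ : size rootpoly <= d)%N) ?size_rootpoly //.
rewrite mulr0 subr0.
case: d kd => //= d kd; rewrite nth_default //; exact: leq_trans Pk kd.
Qed.

Section Ideal.
Variables (m : nat) (g : 'I_m -> S).
Local Notation J := (submod (gen_ideal_submod g)).

Lemma ideal_mull (a b : S) : b \in J -> a * b \in J.
Proof. exact: gen_ideal_mull. Qed.

Lemma det_congr (M N : 'M[S]_k) :
  (forall i j, M i j - N i j \in J) -> \det M - \det N \in J.
Proof.
move=> MN; rewrite -sumrB; apply: rpred_sum => s _.
rewrite -mulrBr ideal_mull //.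
elim/big_rec2: _ => [|i a b _ ab]; first by rewrite subrr rpred0.
have -> : M i (s i) * b - N i (s i) * a =
    b * (M i (s i) - N i (s i)) + N i (s i) * (b - a).
  by rewrite !mulrBr addrA [b * N _ _]mulrC subrK [M _ _ * b]mulrC.
rewrite rpredD // ideal_mull //.
Qed.

Lemma res_coef_ideal P Q :
  (forall d, P`_d \in J) -> forall d, (res (P * Q))`_d \in J.
Proof.
move=> PJ d; rewrite -[P]coefK poly_def mulr_suml.
rewrite rmodp_sum ?monic_rootpoly // coef_sum; apply: rpred_sum => i _.
by rewrite -scalerAl rmodpZ ?monic_rootpoly // coefZ mulrC ideal_mull.
Qed.

(** Multiplying a residue by t and reducing shifts its coefficients up by one,
    apart from a multiple of the top coefficient. So the coefficient of degree
    k - 1 - e of P agrees, modulo the coefficients above it, with the top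
    coefficient of the residue of t^e P, and the coefficients are recovered
    from the top downwards. Only the first k powers of t are used, one for
    each relation. *)
Lemma top_coefs_ideal P : (size P <= k)%N ->
  (forall i, (res (P * 'X^i))`_k.-1 \in J) -> forall d, P`_d \in J.
Proof.
case: (posnP k) => [k0 /leq_trans + _ d|k0].
  by move=> /(_ d) Pd; rewrite nth_default ?rpred0 // Pd // k0.
suff H e : forall P, (e < k)%N -> (size P <= k)%N ->
    (forall i : nat, (i <= e)%N -> (res (P * 'X^i))`_k.-1 \in J) ->
    P`_(k.-1 - e) \in J.
  move=> Pk PJ d; case: (ltnP d k) => [dk|kd]; last first.
    by rewrite nth_default ?rpred0 // (leq_trans Pk).
  have dk' : (d <= k.-1)%N by rewrite -ltnS prednK.
  rewrite -(subKn dk'); apply: H => // [|i ie].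
    by rewrite -[X in (_ < X)%N](prednK k0) ltnS leq_subr.
  have ik : (i < k)%N.
    by rewrite -[X in (_ < X)%N](prednK k0) ltnS (leq_trans ie) ?leq_subr.
  exact: (PJ (Ordinal ik)).
elim: e => [|e IHe] {}P ek Pk PJ.
  by have := PJ 0%N isT; rewrite expr0 mulr1 res_small // subn0.
have := IHe (res (P * 'X)) (ltnW ek) (size_res _).
have top : P`_k.-1 \in J by have := PJ 0%N isT; rewrite expr0 mulr1 res_small.
have ek1 : (e < k.-1)%N by rewrite -ltnS prednK.
rewrite res_mulX // coefB coefMX coefZ subn_eq0 leqNgt ek1 /= -subnS => Hres.
rewrite -[P`_(_ - e.+1)](subrK (P`_k.-1 * rootpoly`_(k.-1 - e))).
rewrite rpredD //; last by rewrite mulrC ideal_mull.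
apply: Hres => i ie; rewrite -res_mulX // rmodp_mulml ?monic_rootpoly //.
by rewrite -mulrA -exprS PJ.
Qed.

End Ideal.
End RootPoly.

(** * The relations of the quantum cohomology ring *)

(*BEGIN*)
Section Relations.
Variables (k n : nat) (A : idomainType) (y : nat -> A) (q : A).
Hypotheses (k_gt0 : (0 < k)%N) (kn : (k <= n)%N).
Hypothesis y_out : forall a, (n <= a)%N -> y a = 0.
Local Notation S := (sympoly k A).
Local Notation E := (rootpoly k A).
Local Notation facpow := (facpow y).
Local Notation spoly := (spoly k).
Implicit Types (i j l : 'I_k) (p : {poly A}) (P Q : {poly S}).

(** The A-linear map that sends (t|y)^(r+k-1) to h_r, see [hsym_topcoef]. *)
Definition topcoef p : S := (rmodp (spoly p) E)`_k.-1.

Lemma topcoefD p1 p2 : topcoef (p1 + p2) = topcoef p1 + topcoef p2.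
Proof. by rewrite /topcoef rmorphD rmodpD ?monic_rootpoly // coefD. Qed.

Lemma topcoefZ (a : A) p : topcoef (a *: p) = a%:A * topcoef p.
Proof.
rewrite /topcoef -mul_polyC rmorphM /= spolyC mul_polyC.
by rewrite rmodpZ ?monic_rootpoly // coefZ.
Qed.

Lemma topcoef_small p : (size p <= k)%N -> topcoef p = (p`_k.-1)%:A.
Proof. by move=> pk; rewrite /topcoef res_small ?size_spoly // coef_spoly. Qed.

Definition hook_rows p i :=
  spoly (if i == 0%N :> nat then p else facpow (k - i.+1)).

(** Reducing only the first row makes the coefficient matrix triangular; its
    diagonal is the top coefficient of that row followed by the leading
    coefficients of the monic polynomials (t|y)^(k-2), ..., 1. *)
Lemma alternant_hook p : alternant (hook_rows p) = val (topcoef p) * vdm k A.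
Proof.
pose F i := rmodp (hook_rows p i) E.
have -> : alternant (hook_rows p) = alternant F.
  by congr (\det _); apply/matrixP => i j; rewrite !mxE xeval_res.
have tailE i : i != 0%N :> nat -> F i = spoly (facpow (k - i.+1)).
  move=> i0; rewrite /F /hook_rows (negbTE i0) res_small // size_spoly.
  rewrite size_facpow.
  by rewrite subnSK // leq_subr.
rewrite alternant_triangular => [|i]; last first.
  case: (eqVneq (i : nat) 0%N) => [i0|i0]; first by rewrite i0 subn0 size_res.
  by rewrite tailE // size_spoly size_facpow subnSK.
rewrite (bigD1 (Ordinal k_gt0)) //= big1 ?mulr1 ?subn1 // => i i0.
rewrite tailE ?coef_spoly //.
have /monicP := monic_facpow y (k - i.+1).
by rewrite lead_coefE size_facpow => ->; rewrite scale1r.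
Qed.

Lemma hsym_topcoef r : hsym k y r = topcoef (facpow (r + k.-1)).
Proof.
apply/val_inj/(mulIf (vdm_neq0 k A)); rewrite fschurE -alternant_hook.
rewrite fschur_num_alternant; apply: eq_alternant => i.
rewrite /hook_rows; case: (eqVneq (i : nat) 0%N) => [->|] //.
by rewrite subn1.
Qed.

(** The characteristic polynomial of the quantised Chern root. *)
Definition qcharpoly : {poly A} := facpow n + ((-1) ^+ k * q)%:P.

Lemma monic_qcharpoly : qcharpoly \is monic.
Proof.
have := monic_facpow y n; rewrite !monicE /qcharpoly lead_coefDl //.
rewrite size_facpow (leq_ltn_trans (size_polyC_leq1 _)) // ltnS.
exact: leq_trans kn.
Qed.

Lemma size_qcharpoly : size qcharpoly = n.+1.
Proof.
rewrite /qcharpoly size_polyDl size_facpow //.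
rewrite (leq_ltn_trans (size_polyC_leq1 _)) // ltnS.
exact: leq_trans kn.
Qed.

Lemma facpow_out d : facpow (n + d) = facpow n * 'X^d.
Proof.
elim: d => [|d IHd]; first by rewrite addn0 expr0 mulr1.
by rewrite addnS facpowS IHd y_out ?leq_addr // subr0 exprSr mulrA.
Qed.

(** Only for r = n does t^i contribute to the top coefficient: then i = k - 1,
    and this is the relation that contains q. *)
Lemma qH_rel_topcoef i : qH_rel n y q i = topcoef (qcharpoly * 'X^i).
Proof.
rewrite mulrDl -facpow_out topcoefD mul_polyC topcoefZ.
rewrite (@topcoef_small 'X^i); last first.
  by rewrite size_polyXn.
have e : (n - k + i.+1 + k.-1 = n + i)%N.
  by rewrite -addnA addSnnS prednK // addnCA subnK // addnC.
rewrite /qH_rel; case: eqVneq => [r|r].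
  rewrite hsym_topcoef -{1}r e coefXn.
  have -> : k.-1 = i.
    by apply/eqP; rewrite -(eqn_add2l n) -e r.
  by rewrite eqxx scale1r mulr1.
rewrite hsym_topcoef e coefXn (_ : (_ == _) = false) ?scale0r ?mulr0 ?addr0 //.
apply/negbTE/(contraNneq _ r) => ki.
by rewrite -(eqn_add2r k.-1) e ki.
Qed.

Local Notation I := (gen_ideal_submod (@qH_rel k n A y q)).

Lemma res_qcharpoly_ideal p d :
  (rmodp (spoly (qcharpoly * p)) E)`_d \in submod I.
Proof.
rewrite rmorphM -rmodp_mulml ?monic_rootpoly //; apply: res_coef_ideal.
apply: top_coefs_ideal => [|i]; first exact: size_res.
rewrite rmodp_mulml ?monic_rootpoly //.
have -> : 'X^i = spoly ('X^i : {poly A}) by rewrite spolyXn.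
rewrite -rmorphM -[_`__]/(topcoef _) -qH_rel_topcoef; apply/asboolP.
exists (fun l => (l == i)%:R); rewrite (bigD1 i) //= eqxx mul1r big1 ?addr0 //.
by move=> l /negbTE ->; rewrite mul0r.
Qed.

(** Replacing the p_i by their remainders changes the coefficient matrix by
    elements of the ideal, hence its determinant as well. *)
Lemma alternant_qmod (p : 'I_k -> {poly A}) : exists2 h : S, h \in submod I &
  alternant (fun i => spoly (p i)) =
  alternant (fun i => spoly (rmodp (p i) qcharpoly)) + val h * vdm k A.
Proof.
have [C [C' [CC' -> ->]]] : exists C C' : 'M[S]_k, [/\
    forall i j, C i j - C' i j \in submod I,
    alternant (fun i => spoly (p i)) = val (\det C) * vdm k A &
    alternant (fun i => spoly (rmodp (p i) qcharpoly)) =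
      val (\det C') * vdm k A].
  do 2!eexists; split; try exact: alternant_res; move=> i j; rewrite !mxE.
  rewrite {1}(rdivp_eq monic_qcharpoly (p i)) rmorphD rmodpD ?monic_rootpoly //.
  by rewrite coefD addrK mulrC res_qcharpoly_ideal.
exists (\det C - \det C'); first exact: det_congr.
by rewrite rmorphB mulrBl addrC subrK.
Qed.

End Relations.

(** * Schubert polynomials span modulo the relations *)

(*BEGIN*)
Section GrassmannianWords.
Variables (k n : nat) (kn : (k <= n)%N).

(** The first k letters of w, which determine it. *)
Definition grass_word (w : grass k n) (i : 'I_k) : 'I_n :=
  val w (widen_ord kn i).

Lemma grass_word_mono (w : grass k n) (i j : 'I_k) :
  (i < j)%N -> (grass_word w i < grass_word w j)%N.
Proof.
move=> ij.
have /forallP/(_ (widen_ord kn i))/forallP/(_ (widen_ord kn j)) := valP w.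
by rewrite /= ij ltn_ord /=.
Qed.

Lemma grass_word_inj w : injective (grass_word w).
Proof.
move=> i j; rewrite /grass_word => /perm_inj/(congr1 val)/= ij.
exact: val_inj.
Qed.

Lemma grass_word_ge w (i : 'I_k) : (i <= grass_word w i)%N.
Proof.
case: i => i; elim: i => // i IHi ik.
apply: leq_ltn_trans (IHi (ltnW ik)) _; exact: grass_word_mono.
Qed.

(** The inequality of the preceding lemma ensures that the truncated
    subtraction in grass_part loses nothing. *)
Lemma grass_part_exponent (w : grass k n) (i : 'I_k) :
  (grass_part kn w i + (k - i.+1) = grass_word w (rev_ord i))%N.
Proof. by rewrite /grass_part subnK // (grass_word_ge w (rev_ord i)). Qed.

(** List the image of phi in increasing order, then its complement. *)
Lemma grass_of_inj (phi : 'I_k -> 'I_n) : injective phi ->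
  exists w : grass k n, exists t : 'S_k, forall i, phi i = grass_word w (t i).
Proof.
move=> phi_inj; pose a := [set phi i | i in 'I_k].
have card_a : #|a| = k by rewrite card_imset ?card_ord.
pose r := enum a ++ enum (~: a).
have size_r : size r = n.
  by rewrite size_cat -!cardE cardsC card_ord.
have uniq_r : uniq r.
  rewrite cat_uniq !enum_uniq andbT /=; apply/hasPn => x.
  by rewrite !mem_enum in_setC.
pose f i := nth i r i.
have fE (i j : 'I_n) : f i = nth j r i.
  by apply: set_nth_default; rewrite size_r.
have f_inj : injective f.
  move=> i j; rewrite (fE j i) => /eqP.
  by rewrite /f nth_uniq ?size_r // => /eqP/val_inj.
have sorted_enum (b : {set 'I_n}) : sorted (fun i j : 'I_n => i < j)%N (enum b).
  rewrite {1}/enum_mem sorted_filter //.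
    by move=> ? ? ?; apply: ltn_trans.
  rewrite -enumT; have := iota_ltn_sorted 0 n.
  by rewrite -val_enum_ord sorted_map.
have mono_nth (b : {set 'I_n}) x (i j : nat) : (i < j < #|b|)%N ->
    (nth x (enum b) i < nth x (enum b) j)%N.
  case/andP=> ij jb.
  apply: (sorted_ltn_nth (leT := fun i j : 'I_n => i < j)%N) => //.
  - by move=> ? ? ?; apply: ltn_trans.
  - by rewrite inE -cardE (ltn_trans ij).
  - by rewrite inE -cardE.
pose w0 := perm f_inj.
have w0_grass : is_grass k w0.
  apply/forallP => i; apply/forallP => j; apply/implyP => /andP[ij ijk].
  rewrite !permE (fE j i) /f !nth_cat -!cardE card_a.
  case: (ltnP j k) ijk => /= [jk _|kj ki].
    by rewrite (ltn_trans ij jk) mono_nth // ij card_a.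
  rewrite (ltnNge i k) ki /= mono_nth // ltn_sub2r ?(leq_ltn_trans ki) //=.
  have -> : #|~: a| = (n - k)%N by rewrite cardsCs setCK card_ord card_a.
  by rewrite ltn_sub2r // (leq_ltn_trans kj).
have idx i : (index (phi i) (enum a) < k)%N.
  by rewrite -card_a cardE index_mem mem_enum imset_f.
have t_inj : injective (fun i => Ordinal (idx i)).
  move=> i j /(congr1 val) /= /index_inj E; apply/phi_inj/(E (phi i));
    by rewrite mem_enum imset_f.
exists (exist _ w0 w0_grass : grass k n), (perm t_inj) => i.
rewrite /grass_word /= permE permE /f /= nth_cat -cardE card_a idx.
by rewrite nth_index // mem_enum imset_f.
Qed.

End GrassmannianWords.

(** The first step of the Cauchy-Binet formula: terms with phi not injective
    vanish, and those with the same image remain to be collected. *)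
Lemma det_sum_rows (B : comNzRingType) (k n : nat) (c : 'I_k -> 'I_n -> B)
    (M : 'I_n -> 'I_k -> B) :
  \det (\matrix_(i, j) \sum_m c i m * M m j) =
  \sum_(phi : {ffun 'I_k -> 'I_n})
     (\prod_i c i (phi i)) * \det (\matrix_(i, j) M (phi i) j).
Proof.
under [RHS]eq_bigr do rewrite mulr_sumr; rewrite exchange_big /=.
apply: eq_bigr => s _; under [RHS]eq_bigr do rewrite mulrCA.
rewrite -mulr_sumr; congr (_ * _).
transitivity (\prod_i \sum_m c i m * M m (s i)).
  by apply: eq_bigr => i _; rewrite mxE.
rewrite bigA_distr_bigA /=; apply: eq_bigr => phi _; rewrite -big_split /=.
by apply: eq_bigr => i _; rewrite mxE.
Qed.

Section Spanning.
Variables (k n : nat) (A : idomainType) (y : nat -> A) (q : A).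
Hypotheses (k_gt0 : (0 < k)%N) (kn : (k <= n)%N).
Hypothesis y_out : forall a, (n <= a)%N -> y a = 0.
Local Notation S := (sympoly k A).
Local Notation facpow := (facpow y).
Local Notation spoly := (spoly k).
Local Notation I := (gen_ideal_submod (@qH_rel k n A y q)).
Implicit Types (i j l : 'I_k) (p : {poly A}) (P Q : {poly S}).

Lemma schubert_num (w : grass k n) :
  fschur_num y (grass_part kn w) =
  alternant (fun i => spoly (facpow (grass_word kn w (rev_ord i)))).
Proof.
rewrite fschur_num_alternant; apply: eq_alternant => i.
by rewrite grass_part_exponent.
Qed.

Lemma alternant_facpow (phi : 'I_k -> 'I_n) : exists c : {ffun grass k n -> A},
  alternant (fun i => spoly (facpow (phi i))) =
  \sum_w c w *: fschur_num y (grass_part kn w).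
Proof.
have [phi_inj|/injectiveP phi_ninj] := pselect (injective phi).
  have [w [t tE]] := grass_of_inj kn phi_inj.
  pose r := perm (@rev_ord_inj k).
  exists [ffun x => (-1) ^+ (t * r)%g *+ (x == w)].
  rewrite (bigD1 w) //= ffunE eqxx big1 ?addr0 => [|x /negbTE xw]; last first.
    by rewrite ffunE xw mulr0n scale0r.
  rewrite schubert_num scaler_sign -mulr_sign -alternant_perm.
  by apply: eq_alternant => i /=; rewrite permM permE rev_ordK tE.
exists [ffun=> 0]; rewrite [RHS]big1 => [|w _]; last by rewrite ffunE scale0r.
case/injectivePn: phi_ninj => i [j ij E].
by apply: (determinant_alternate ij) => l; rewrite !mxE E.
Qed.

(** The (t|y)^m are monic of degree m. *)
Lemma newton_basis p d : (size p <= d)%N ->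
  exists c : nat -> A, p = \sum_(m < d) c m *: facpow m.
Proof.
elim: d p => [|d IHd] p pd.
  by exists (fun=> 0); rewrite big_ord0; apply/eqP; rewrite -size_poly_leq0.
have [|c cE] := IHd (p - p`_d *: facpow d).
  apply/leq_sizeP => e; rewrite leq_eqVlt coefB coefZ.
  have /monicP := monic_facpow y d; rewrite lead_coefE size_facpow /= => top.
  case/orP => [/eqP <-|de]; first by rewrite top mulr1 subrr.
  rewrite nth_default ?(leq_trans pd) //.
  rewrite [(facpow d)`_e]nth_default ?size_facpow //.
  by rewrite mulr0 subr0.
exists (fun m => if m == d then p`_d else c m).
rewrite big_ord_recr /= eqxx -[LHS](subrK (p`_d *: facpow d)) cE; congr (_ + _).
by apply: eq_bigr => m _; rewrite ltn_eqF.
Qed.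

(** Membership is tested after multiplication by the Vandermonde, so that
    single alternants, rather than their quotients by it, can be treated. *)
Definition schubert_spanned (g : {mpoly A[k]}) :=
  exists c : {ffun grass k n -> A}, exists2 h : S, h \in submod I &
  g = \sum_w c w *: fschur_num y (grass_part kn w) + val h * vdm k A.

Lemma schubert_spannedD g1 g2 :
  schubert_spanned g1 -> schubert_spanned g2 -> schubert_spanned (g1 + g2).
Proof.
move=> [c1 [h1 h1I ->]] [c2 [h2 h2I ->]]; exists [ffun w => c1 w + c2 w].
exists (h1 + h2); first exact: rpredD.
under [X in _ = X + _]eq_bigr do rewrite ffunE scalerDl.
by rewrite big_split rmorphD mulrDl addrACA.
Qed.

Lemma schubert_spannedZ a g :
  schubert_spanned g -> schubert_spanned (a *: g).
Proof.
move=> [c [h hI ->]]; exists [ffun w => a * c w].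
exists (a *: h); first exact: rpredZ.
rewrite scalerDr scaler_sumr; congr (_ + _).
  by apply: eq_bigr => w _; rewrite ffunE scalerA.
by rewrite linearZ /= scalerAl.
Qed.

Lemma schubert_spanned_sum (T : Type) (r : seq T) (F : T -> {mpoly A[k]}) :
  (forall x, schubert_spanned (F x)) -> schubert_spanned (\sum_(x <- r) F x).
Proof.
move=> FS; elim/big_ind: _ => //; last exact: schubert_spannedD.
exists [ffun=> 0], 0; first exact: rpred0.
by rewrite big1 ?rmorph0 ?mul0r ?addr0 // => w _; rewrite ffunE scale0r.
Qed.

Lemma alternant_spanned (p : 'I_k -> {poly A}) :
  schubert_spanned (alternant (fun i => spoly (p i))).
Proof.
have mq := @monic_qcharpoly k n A y q k_gt0 kn.
have [h hI ->] := alternant_qmod q k_gt0 kn y_out p.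
apply: schubert_spannedD; last first.
  exists [ffun=> 0], h => //.
  by rewrite big1 ?add0r // => w _; rewrite ffunE scale0r.
have newton i : exists c : nat -> A,
    rmodp (p i) (qcharpoly k n y q) = \sum_(m < n) c m *: facpow m.
  apply: newton_basis; rewrite -ltnS -(size_qcharpoly y q k_gt0 kn).
  by rewrite ltn_rmodp monic_neq0.
have [c cE] := fin_all_exists newton.
have -> : alternant (fun i => spoly (rmodp (p i) (qcharpoly k n y q))) =
    \det (\matrix_(i, j) \sum_(m < n) (c i m)%:MP * fpow y j m).
  congr (\det _); apply/matrixP => i j; rewrite !mxE cE !rmorph_sum /=.
  apply: eq_bigr => m _; rewrite -mul_polyC !rmorphM /= xeval_facpow.
  by congr (_ * _); rewrite spolyC xevalC; apply: val_alg.
rewrite det_sum_rows; apply: schubert_spanned_sum => phi.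
rewrite -rmorph_prod mul_mpolyC; apply: schubert_spannedZ.
have -> : \det (\matrix_(i, j) fpow y j (phi i)) =
    alternant (fun i => spoly (facpow (phi i))).
  by congr (\det _); apply/matrixP => i j; rewrite !mxE xeval_facpow.
have [d ->] := alternant_facpow phi.
by exists d, 0; rewrite ?rpred0 // rmorph0 mul0r addr0.
Qed.

(** In the Leibniz expansion of the Vandermonde, p may be permuted along with
    each term since it is symmetric. *)
Lemma sym_vdm (p : S) : val p * vdm k A =
  \sum_(m <- msupp (val p)) (val p)@_m *:
     alternant (fun i => spoly ('X^(m i + (k - i.+1)) : {poly A})).
Proof.
rewrite vdm_det /(\det _) mulr_sumr; under [RHS]eq_bigr do rewrite scaler_sumr.
rewrite exchange_big /=; apply: eq_bigr => s _.
have /issymP/(_ s) pE := valP p.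
rewrite mulrCA -[X in X * \prod_(i < k) _]pE [in msym s _](mpolyE (val p)).
rewrite raddf_sum mulr_suml mulr_sumr; apply: eq_bigr => m _ /=.
rewrite msymZ -scalerAl -scalerAr; congr (_ *: (_ * _)).
rewrite mpolyXE_id rmorph_prod -big_split; apply: eq_bigr => i _ /=.
rewrite !mxE rmorphXn /= msymXU -exprD.
by rewrite xeval_spolyXn.
Qed.

Lemma schubert_span (p : S) : exists c : {ffun grass k n -> A},
  p - \sum_w c w *: schubert kn y w \in submod I.
Proof.
have [c [h hI pE]] : schubert_spanned (val p * vdm k A).
  rewrite sym_vdm; apply: schubert_spanned_sum => m; apply: schubert_spannedZ.
  exact: alternant_spanned.
exists c; suff -> : p - \sum_w c w *: schubert kn y w = h by [].
apply/val_inj/(mulIf (vdm_neq0 k A)); rewrite rmorphB mulrBl pE raddf_sum.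
rewrite mulr_suml addrAC; apply/eqP.
rewrite -subr_eq0 addrK subr_eq0; apply/eqP.
apply: eq_bigr => w _; rewrite -fschurE scalerAl; congr (_ * _).
Qed.

End Spanning.

(** * Symmetric polynomials acting on tensors *)

(*BEGIN*)
Section PolyAction.
Variables (n : nat) (A : comNzRingType) (M : 'M[A]_n) (v : 'cV[A]_n).
Implicit Types p : {poly A}.

(** The vector p(M) v. *)
Definition polyact p : 'cV[A]_n :=
  \sum_(d < size p) p`_d *: iter d (mulmx M) v.

Lemma polyact_wide p d : (size p <= d)%N ->
  polyact p = \sum_(e < d) p`_e *: iter e (mulmx M) v.
Proof.
move=> pd; rewrite /polyact.
rewrite (big_ord_widen _ (fun e => p`_e *: iter e (mulmx M) v) pd).
rewrite big_mkcond /=; apply: eq_bigr => e _.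
by case: ltnP => // pe; rewrite nth_default // scale0r.
Qed.

Lemma polyact_linear a p1 p2 :
  polyact (a *: p1 + p2) = a *: polyact p1 + polyact p2.
Proof.
pose d := (size (a *: p1 + p2)%R + (size p1 + size p2))%N.
rewrite !(@polyact_wide _ d) ?leq_addr //; last first.
- by rewrite /d addnC -addnA leq_addr.
- by rewrite /d addnA leq_addl.
rewrite scaler_sumr -big_split; apply: eq_bigr => e _ /=.
by rewrite coefD coefZ scalerDl scalerA.
Qed.

Lemma polyactB p1 p2 : polyact (p1 - p2) = polyact p1 - polyact p2.
Proof. by rewrite addrC -scaleN1r polyact_linear scaleN1r addrC. Qed.
Lemma polyactZ a p : polyact (a *: p) = a *: polyact p.
Proof.
have p0 : polyact 0 = 0 by rewrite /polyact size_poly0 big_ord0.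
by rewrite -[a *: p]addr0 polyact_linear p0 addr0.
Qed.

Lemma polyact1 : polyact 1 = v.
Proof. by rewrite /polyact size_poly1 big_ord1 coef1 scale1r. Qed.

Lemma polyact_mulX p : polyact (p * 'X) = M *m polyact p.
Proof.
rewrite (@polyact_wide (p * 'X) (size p).+1); last first.
  by rewrite (leq_trans (size_polyMleq _ _)) // size_polyX addn2.
rewrite big_ord_recl coefMX /= scale0r add0r mulmx_sumr.
by apply: eq_bigr => e _; rewrite coefMX /= scalemxAr.
Qed.

Lemma polyact_mulXn_eq0 p d : polyact p = 0 -> polyact (p * 'X^d) = 0.
Proof.
move=> p0; elim: d => [|d IHd]; first by rewrite expr0 mulr1.
by rewrite exprSr mulrA polyact_mulX IHd mulmx0.
Qed.
End PolyAction.

Section TensorAction.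
Variables (n k : nat) (A : idomainType) (M : 'M[A]_n) (X : 'M[A]_(n, k)).
Local Notation spoly := (spoly k).
Local Notation act := (@tensor_act n k A M).
Implicit Types (g h : {mpoly A[k]}) (t : tensor n k A) (p : {poly A}).

Lemma tensor_act_wide g t d : (msize g <= d)%N ->
  act g t = \sum_(m : 'X_{1..k < d}) g@_m *: tensor_mon M m t.
Proof.
move=> gd; rewrite /tensor_act.
rewrite (big_mksub ('X_{1..k < d} : subFinType _)) /=; first last.
  by move=> x /msize_mdeg_lt /leq_trans; apply.
  by rewrite msupp_uniq.
by rewrite big_rmcond //= => j /memN_msupp_eq0 ->; rewrite scale0r.
Qed.

Lemma tensor_act_linear_poly a g h t :
  act (a *: g + h) t = a *: act g t + act h t.
Proof.
pose d := (msize (a *: g + h)%R + (msize g + msize h))%N.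
rewrite !(@tensor_act_wide _ _ d) ?leq_addr //; last first.
- by rewrite /d addnC -addnA leq_addr.
- by rewrite /d addnA leq_addl.
rewrite scaler_sumr -big_split; apply: eq_bigr => e _ /=.
by rewrite mcoeffD mcoeffZ scalerDl scalerA.
Qed.

Lemma tensor_act0 t : act 0 t = 0.
Proof. by rewrite /tensor_act msupp0 big_nil. Qed.
Lemma tensor_actZ a g t : act (a *: g) t = a *: act g t.
Proof. by rewrite -[a *: g]addr0 tensor_act_linear_poly tensor_act0 addr0. Qed.
Lemma tensor_actD g h t : act (g + h) t = act g t + act h t.
Proof. by rewrite -[g in LHS]scale1r tensor_act_linear_poly scale1r. Qed.
Lemma tensor_act_sum (T : Type) (r : seq T) (F : T -> {mpoly A[k]}) t :
  act (\sum_(x <- r) F x) t = \sum_(x <- r) act (F x) t.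
Proof.
exact: (big_morph (act^~ t) (fun g h => tensor_actD g h t) (tensor_act0 t)).
Qed.
Lemma tensor_act_X m t : act 'X_[m] t = tensor_mon M m t.
Proof. by rewrite /tensor_act msuppX big_seq1 mcoeffX eqxx scale1r. Qed.

Lemma tensor_actMr0 g : act g 0 = 0.
Proof.
rewrite -[0 in LHS](subrr 0) addrC -scaleN1r tensor_act_linear.
by rewrite scaleN1r addNr.
Qed.

Lemma tensor_mon_mul m1 m2 : tensor_mon M (m1 + m2)%MM (elem_tensor X) =
  tensor_mon M m1 (tensor_mon M m2 (elem_tensor X)).
Proof.
rewrite !tensor_mon_elem; congr elem_tensor; apply/matrixP => a l.
rewrite !mxE mnmDE iterD; suff -> : col l (mon_mx M X m2) =
  iter (m2 l) (mulmx M) (col l X) by [].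
by apply/matrixP => b c; rewrite !mxE ord1.
Qed.

Lemma tensor_act_mul g h :
  act (g * h) (elem_tensor X) = act g (act h (elem_tensor X)).
Proof.
elim/mpolyind: g => [|a m g _ _ IHg]; first by rewrite mul0r !tensor_act0.
rewrite mulrDl -scalerAl !tensor_act_linear_poly {}IHg; congr (a *: _ + _).
elim/mpolyind: h => [|b m' h _ _ IHh].
  by rewrite mulr0 !tensor_act0 tensor_actMr0.
rewrite mulrDr -scalerAr !tensor_act_linear_poly tensor_act_linear IHh.
by rewrite -mpolyXD !tensor_act_X tensor_mon_mul.
Qed.

Lemma tensor_act_prod (p : 'I_k -> {poly A}) :
  act (\prod_l xeval l (spoly (p l))) (elem_tensor X) =
  elem_tensor (\matrix_(a, l) polyact M (col l X) (p l) a 0).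
Proof.
pose d := \max_l size (p l).
have pd l : (size (p l) <= d)%N by apply: leq_bigmax.
under eq_bigr do rewrite (xeval_spoly_coef _ (pd _)).
rewrite bigA_distr_bigA /= tensor_act_sum; apply/ffunP => b.
rewrite ffunE sum_ffunE.
transitivity (\prod_l \sum_(e < d)
    (p l)`_e * iter e (mulmx M) (col l X) (b l) 0).
  rewrite bigA_distr_bigA /=; apply: eq_bigr => phi _.
  rewrite scaler_prod tensor_actZ ffunE big_split /=; congr (_ * _).
  have -> : \prod_l 'X_l ^+ phi l =
      'X_[[multinom nat_of_ord (phi l) | l < k]] :> {mpoly A[k]}.
    by rewrite mpolyXE_id; apply: eq_bigr => l _; rewrite mnmE.
  rewrite tensor_act_X tensor_mon_elem ffunE; apply: eq_bigr => l _.
  by rewrite !mxE mnmE.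
apply: eq_bigr => l _; rewrite mxE (polyact_wide _ _ (pd l)) summxE.
by apply: eq_bigr => e _; rewrite !mxE.
Qed.

(** By linearity g may be a monomial, and then the product is again one of
    polynomials in separate variables, the l-th of which is a multiple of p. *)
Lemma tensor_act_kill l p g : polyact M (col l X) p = 0 ->
  act (g * xeval l (spoly p)) (elem_tensor X) = 0.
Proof.
move=> p0; elim/mpolyind: g => [|a m g _ _ IHg].
  by rewrite mul0r tensor_act0.
rewrite mulrDl -scalerAl tensor_act_linear_poly {}IHg addr0.
pose r j : {poly A} := if j == l then p * 'X^(m j) else 'X^(m j).
have -> : 'X_[m] * xeval l (spoly p) = \prod_j xeval j (spoly (r j)).
  rewrite mpolyXE_id (bigD1 l) //= mulrAC [RHS](bigD1 l) //= /r eqxx.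
  rewrite xeval_spolyM xeval_spolyXn ['X_l ^+ _ * _]mulrC.
  congr (_ * _); apply: eq_bigr => j /negbTE ->.
  by rewrite xeval_spolyXn.
rewrite tensor_act_prod; apply/ffunP => b; rewrite !ffunE (bigD1 l) //= mxE.
by rewrite /r eqxx polyact_mulXn_eq0 // mxE mul0r scaler0.
Qed.

(** When all factors of the initial tensor coincide, permuting the variables
    of the operator permutes the factors of the result. *)
Lemma tensor_act_msym (s : 'S_k) g (b : {ffun 'I_k -> 'I_n}) :
  (forall i j, col i X = col j X) ->
  act (msym s g) (elem_tensor X) b = act g (elem_tensor X) [ffun l => b (s l)].
Proof.
move=> Xc; elim/mpolyind: g => [|a m g _ _ IHg].
  by rewrite msym0 !tensor_act0 !ffunE.
rewrite msymD msymZ !tensor_act_linear_poly !ffunE; congr (_ + _) => //.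
congr (a *: _); rewrite msymX !tensor_act_X !tensor_mon_elem !ffunE.
rewrite (reindex_inj (@perm_inj _ s)); apply: eq_bigr => l _ /=.
by rewrite !mxE !ffunE mnmE permK (Xc (s l) l).
Qed.

Lemma tensor_pairing_basis (t : tensor n k A) (phi : 'I_k -> 'I_n) :
  tensor_pairing (elem_tensor (\matrix_(a, l) (a == phi l)%:R)) t =
  \sum_(s : 'S_k) (-1) ^+ s * t [ffun l => phi (s l)].
Proof.
rewrite tensor_pairingC /tensor_pairing.
under eq_bigr do [under eq_bigr do rewrite -mulrA;
  rewrite -mulr_sumr elem_tensor_pairing].
under eq_bigr do rewrite mulr_sumr; rewrite exchange_big /=.
apply: eq_bigr => s _; pose b := [ffun l => phi (s l)].
rewrite (bigD1 b) //= [X in _ + X]big1 => [|a ne]; last first.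
  suff [i ai] : exists i, a i != phi (s i).
    by rewrite (bigD1 i) //= !mxE (negbTE ai) mul0r !mulr0.
  apply/existsP; apply: contraR ne; rewrite negb_exists => /forallP H.
  by apply/eqP/ffunP => i; rewrite ffunE; apply/eqP; have := H i; rewrite negbK.
rewrite addr0 big1 => [|i _]; first by rewrite mulr1 mulrC.
by rewrite !mxE ffunE eqxx.
Qed.

End TensorAction.

(** * Grassmannian words and the quantised Chern root *)

(*BEGIN*)
Lemma increasing_ge_id n (f : 'I_n -> 'I_n) :
  (forall i j : 'I_n, (i < j)%N -> (f i < f j)%N) ->
  forall i : 'I_n, (i <= f i)%N.
Proof.
move=> f_mono [i]; elim: i => // i IHi ilt.
by apply: leq_ltn_trans (IHi (ltnW ilt)) _; apply: f_mono.
Qed.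

Lemma increasing_perm_id n (s : 'S_n) :
  (forall i j : 'I_n, (i < j)%N -> (s i < s j)%N) -> s = 1%g.
Proof.
move=> s_mono.
have sV_mono (i j : 'I_n) : (i < j)%N -> ((s^-1)%g i < (s^-1)%g j)%N.
  move=> ij; rewrite ltnNge leq_eqVlt; apply/norP; split.
    apply: contraL ij => /eqP /val_inj /perm_inj ->; by rewrite ltnn.
  by apply: contraL ij => /s_mono; rewrite !permKV -leqNgt => /ltnW.
apply/permP => i; rewrite perm1; apply/val_inj/eqP.
rewrite eqn_leq (increasing_ge_id s_mono) andbT.
by have := increasing_ge_id sV_mono (s i); rewrite permK.
Qed.

Section GrassmannianPairing.
Variables (k n : nat) (kn : (k <= n)%N).
Implicit Types x w : grass k n.
Local Notation word := (grass_word kn).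

(** The permutation s with w s = x preserves the set of the first k positions
    and its complement, and increases on both because x and w do. So s is
    increasing, hence the identity. *)
Lemma grass_eq x w : (forall i, exists j, word x i = word w j) -> x = w.
Proof.
move=> sub; pose s := (val x * (val w)^-1)%g.
have wsE i : val w (s i) = val x i by rewrite permM permKV.
have [t tE] := fin_all_exists sub.
have s_low (i : 'I_n) : (i < k)%N -> (s i < k)%N.
  move=> ik; have := tE (Ordinal ik); rewrite /grass_word.
  have -> : widen_ord kn (Ordinal ik) = i by apply: val_inj.
  by rewrite -wsE => /perm_inj -> /=.
have t_inj : injective t.
  move=> i j ij; apply: (@grass_word_inj _ _ kn x); by rewrite !tE ij.
have s_high (i : 'I_n) : (k <= i)%N -> (k <= s i)%N.
  rewrite leqNgt => ik; rewrite leqNgt; apply: contra ik => sik.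
  have [r _ rK] := injF_bij t_inj.
  have := tE (r (Ordinal sik)); rewrite rK /grass_word.
  have -> : widen_ord kn (Ordinal sik) = s i by apply: val_inj.
  by rewrite wsE => /perm_inj/(congr1 val) /= <-.
have grassP (v : grass k n) (i j : 'I_n) :
    (i < j)%N -> (j < k)%N || (k <= i)%N -> (val v i < val v j)%N.
  move=> ij ijk; have /forallP/(_ i)/forallP/(_ j) := valP v.
  by rewrite ij ijk.
suff s1 : s = 1%g.
  by apply/val_inj/permP => i; rewrite -wsE s1 perm1.
apply: increasing_perm_id => i j ij.
have [jk|kj] := ltnP j k; last have [ik|ki] := ltnP i k.
- have xij : (val x i < val x j)%N by rewrite grassP ?jk.
  rewrite ltnNge leq_eqVlt; apply/norP; split.
    by apply: contraL ij => /eqP/val_inj/perm_inj ->; rewrite ltnn.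
  apply: contraL xij => /(grassP w); rewrite !wsE s_low // => [/(_ isT)/ltnW|].
    by rewrite -leqNgt.
  exact: ltn_trans jk.
- exact: leq_trans (s_low _ ik) (s_high _ kj).
have xij : (val x i < val x j)%N by rewrite grassP ?ki ?orbT.
rewrite ltnNge leq_eqVlt; apply/norP; split.
  by apply: contraL ij => /eqP/val_inj/perm_inj ->; rewrite ltnn.
apply: contraL xij => /(grassP w); rewrite !wsE s_high // orbT => /(_ isT)/ltnW.
by rewrite -leqNgt.
Qed.

(** For x different from w some letter of x does not occur in w, and its row
    vanishes. *)
Lemma grass_det (B : comNzRingType) x w :
  \det (\matrix_(i < k, j < k) (word x i == word w j)%:R) = (x == w)%:R :> B.
Proof.
have [->|ne] := eqVneq x w.
  rewrite -[RHS](det1 _ k); congr (\det _); apply/matrixP => i j; rewrite !mxE.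
  by rewrite (inj_eq (@grass_word_inj _ _ kn w)).
have /existsP[i /forallP xi] : [exists i, [forall j, word x i != word w j]].
  apply: contraNT ne; rewrite negb_exists => /forallP H.
  apply/eqP/grass_eq => i; have := H i; rewrite negb_forall => /existsP[j].
  by rewrite negbK => /eqP; exists j.
rewrite (expand_det_row _ i) big1 // => j _.
by rewrite mxE (negbTE (xi j)) mul0r.
Qed.
End GrassmannianPairing.

Section ChernRoot.
Variables (k n : nat) (A : idomainType) (y : nat -> A) (q : A).
Hypotheses (k_gt0 : (0 < k)%N) (kn : (k <= n)%N).
Local Notation M := (quantised_chern_root k n y q).

(** The natural number d may be at least n, and then the vector is 0: this is
    the value that [chern_root_basis] needs for d = n. *)
Definition basis_vec (d : nat) : 'cV[A]_n := \col_a (a == d :> nat)%:R.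

Let n_gt0 : (0 < n)%N := leq_trans k_gt0 kn.

Lemma chern_root_basis (d : 'I_n) : M *m basis_vec d =
  basis_vec d.+1 + ((-1) ^+ k.-1 * q) *+ (d.+1 == n) *: basis_vec 0
  + y d *: basis_vec d.
Proof.
apply/colP => a.
rewrite !mxE (bigD1 d) //= !mxE eqxx mulr1 big1 ?addr0; last first.
  by move=> b /negbTE bd; rewrite !mxE (val_eqE b d) bd mulr0.
have -> : (d == n.-1 :> nat) = (d.+1 == n) by rewrite -eqSS prednK.
congr (_ + _); last first.
  by rewrite val_eqE; case: eqVneq => [->|]; rewrite ?mulr1 ?mulr0.
rewrite addrC; congr (_ + _).
by case: eqP; case: eqP; rewrite ?mulr0n ?mulr1n ?mulr0 ?mulr1 ?mul0r.
Qed.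

Lemma polyact_facpow d : (d < n)%N ->
  polyact M (basis_vec 0) (facpow y d) = basis_vec d.
Proof.
elim: d => [|d IHd] dn.
  by rewrite /facpow big_ord0 polyact1.
have dn' := ltnW dn.
rewrite facpowS mulrBr [facpow y d * _%:P]mulrC mul_polyC polyactB polyact_mulX.
rewrite polyactZ IHd // (chern_root_basis (Ordinal dn')) /= (ltn_eqF dn).
by rewrite mulr0n scale0r addr0 addrK.
Qed.

(** The last step, applied to v_n, returns (-1)^(k-1) q v_1, which the
    constant (-1)^k q of the polynomial cancels. *)
Lemma polyact_qcharpoly : polyact M (basis_vec 0) (qcharpoly k n y q) = 0.
Proof.
rewrite /qcharpoly -[in facpow y n](prednK n_gt0) facpowS.
have lt1 : (n.-1 < n)%N by rewrite prednK.
rewrite mulrBr [facpow y _ * _%:P]mulrC mul_polyC.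
rewrite -alg_polyC addrC polyact_linear polyact1 polyactB polyact_mulX.
rewrite polyactZ polyact_facpow // (chern_root_basis (Ordinal lt1)) /= addrK.
rewrite prednK // eqxx mulr1n -{1}(prednK k_gt0) exprS mulN1r mulNr scaleNr.
rewrite addrCA addNr addr0; apply/colP => a; rewrite !mxE.
by rewrite ltn_eqF.
Qed.
End ChernRoot.

(** * Comparison of the two products *)

(*BEGIN*)
Section Main.
Variables (k n : nat) (A : idomainType) (y : nat -> A) (q : A).
Hypotheses (k_gt0 : (0 < k)%N) (kn : (k <= n)%N).
Hypothesis y_out : forall a, (n <= a)%N -> y a = 0.
Local Notation S := (sympoly k A).
Local Notation M := (quantised_chern_root k n y q).
Local Notation facpow := (facpow y).
Local Notation spoly := (spoly k).
Local Notation word := (grass_word kn).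
Local Notation I := (gen_ideal_submod (@qH_rel k n A y q)).

(** The columns of v_1 (x) ... (x) v_1, from which symmetric and other
    polynomials in the X_i^q create all tensors. *)
Definition vacuum : 'M[A]_(n, k) := \matrix_(a, l) basis_vec n A 0 a 0.

Lemma col_vacuum l : col l vacuum = basis_vec n A 0.
Proof. by apply/colP => a; rewrite !mxE. Qed.

(** The functional T_w of the introduction. *)
Definition amplitude (w : grass k n) (g : {mpoly A[k]}) : A :=
  tensor_act M g (elem_tensor vacuum) [ffun l => word w l].

Lemma amplitudeD w g h : amplitude w (g + h) = amplitude w g + amplitude w h.
Proof. by rewrite /amplitude tensor_actD ffunE. Qed.
Lemma amplitudeZ w a g : amplitude w (a *: g) = a * amplitude w g.
Proof. by rewrite /amplitude tensor_actZ ffunE. Qed.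
Lemma amplitude_sum w (T : Type) (r : seq T) (F : T -> {mpoly A[k]}) :
  amplitude w (\sum_(x <- r) F x) = \sum_(x <- r) amplitude w (F x).
Proof. by rewrite /amplitude tensor_act_sum sum_ffunE. Qed.

Lemma elem_tensor_word (x : 'I_k -> 'I_n) :
  elem_tensor (\matrix_(a, l) (a == x l)%:R) =
  tensor_act M (\prod_l xeval l (spoly (facpow (x l)))) (elem_tensor vacuum).
Proof.
rewrite tensor_act_prod; congr elem_tensor; apply/matrixP => a l.
by rewrite !mxE col_vacuum polyact_facpow // mxE.
Qed.

Lemma msym_xeval (s : 'S_k) l (P : {poly S}) :
  msym s (xeval l P) = xeval (s l) P.
Proof.
rewrite !(xevalE _ (leqnn (size P))) raddf_sum; apply: eq_bigr => d _ /=.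
by rewrite msymM rmorphXn /= msymXU; have /issymP -> := valP P`_d.
Qed.

Lemma alternant_msym (F : 'I_k -> {poly S}) :
  alternant F = \sum_(s : 'S_k) (-1) ^+ s *: msym s (\prod_l xeval l (F l)).
Proof.
apply: eq_bigr => s _; rewrite -signr_odd scaler_sign -mulr_sign signr_odd.
congr (_ * _); rewrite rmorph_prod; apply: eq_bigr => l _ /=.
by rewrite mxE msym_xeval.
Qed.

(** Pairing with <w| is an alternating sum over the rearrangements of the
    factors of w. Each rearrangement can be carried out on the creating
    polynomial instead; there it fixes p, and the alternating sum of the rest
    is an alternant. *)
Lemma pairing_amplitude (p : S) (v w : grass k n) :
  ext_pairing (grass_wedge kn A w) (ext_act M p (grass_wedge kn A v)) =
  amplitude w (val p * alternant (fun l => spoly (facpow (word v l)))).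
Proof.
rewrite ext_act_pi ext_pairing_pi.
rewrite (tensor_pairing_basis _ (word w)) (elem_tensor_word (word v)).
rewrite -tensor_act_mul alternant_msym mulr_sumr amplitude_sum.
apply: eq_bigr => s _; rewrite -scalerAr amplitudeZ; congr (_ * _).
have /issymP/(_ s) <- := valP p; rewrite -msymM /amplitude tensor_act_msym.
  by congr (tensor_act _ _ _ _); apply/ffunP => l; rewrite !ffunE.
by move=> i j; rewrite !col_vacuum.
Qed.

Lemma amplitude_word (x w : grass k n) :
  amplitude w (alternant (fun l => spoly (facpow (word x l)))) = (x == w)%:R.
Proof.
rewrite -(grass_det kn) alternant_msym amplitude_sum.
apply: eq_bigr => s _; rewrite amplitudeZ; congr (_ * _).
rewrite /amplitude tensor_act_msym => [|i j]; last by rewrite !col_vacuum.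
rewrite -elem_tensor_word ffunE; apply: eq_bigr => l _.
by rewrite !mxE !ffunE eq_sym.
Qed.

(** Words increase, whereas the exponents in the numerator of a Schur
    polynomial decrease; this is the sign of the reversal. *)
Definition rev_sign : A := (-1) ^+ perm (@rev_ord_inj k).

Lemma schubert_num_word (x : grass k n) :
  alternant (fun l => spoly (facpow (word x l))) =
  rev_sign *: (val (schubert kn y x) * vdm k A).
Proof.
rewrite fschurE schubert_num.
have -> : alternant (fun i => spoly (facpow (word x (rev_ord i)))) =
    alternant ((fun i => spoly (facpow (word x i))) \o perm (@rev_ord_inj k)).
  by apply: eq_alternant => i /=; rewrite permE.
rewrite alternant_perm /rev_sign scaler_sign mulr_sign.
by case: (odd_perm _); rewrite ?opprK.
Qed.

(** A relation times the Vandermonde is an alternant with first row f(x_j)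
    x_j^i, and f(x_j) acts as 0 on the tensors created from the vacuum. *)
Lemma amplitude_ideal w (h : S) : h \in submod I ->
  amplitude w (val h * vdm k A) = 0.
Proof.
move=> /asboolP[c ->]; rewrite raddf_sum mulr_suml amplitude_sum big1 // => i _.
rewrite -[X in X * vdm _ _]/(val (c i) * val (qH_rel n y q i)) -mulrA.
rewrite (qH_rel_topcoef q k_gt0 kn y_out) -(alternant_hook y) //.
rewrite /alternant (expand_det_row _ (Ordinal k_gt0)) mulr_sumr amplitude_sum.
rewrite big1 // => j _; rewrite mxE /hook_rows /= xeval_spolyM mulrA.
rewrite -mulrA mulrC -!mulrA mulrC /amplitude tensor_act_kill ?ffunE //.
by rewrite col_vacuum polyact_qcharpoly.
Qed.

(** Any expansion of the product satisfies the formula, in particular the one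
    chosen by gw, which exists because the Schubert polynomials span: multiply
    it by the Vandermonde, apply T_w and discard the ideal. *)
Lemma gw_pairing (u v w : grass k n) :
  gw kn y q u v w =
  ext_pairing (grass_wedge kn A w)
    (ext_act M (schubert kn y u) (grass_wedge kn A v)).
Proof.
pose pi (p : S) := \pi_(@qH k n A y q) p.
have toI (c : {ffun grass k n -> A}) : schubert_expansion kn y q u v c <->
    schubert kn y u * schubert kn y v - \sum_x c x *: schubert kn y x
      \in submod I.
  rewrite /schubert_expansion /= /schubert_class.
  have -> : \sum_x c x *: pi (schubert kn y x) =
      pi (\sum_x c x *: schubert kn y x).
    rewrite /pi raddf_sum; apply: eq_bigr => x _.
    exact/esym/pi_quotmod_scale.
  have -> : pi (schubert kn y u) * pi (schubert kn y v) =
      pi (schubert kn y u * schubert kn y v).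
    exact/esym/pi_quotalg_mul.
  by split=> [/quotmod_eqP|?] //; apply/quotmod_eqP.
have [c0 c0P] := schubert_span q k_gt0 kn y_out
  (schubert kn y u * schubert kn y v).
have /toI := classical_sets.xgetPex 0 (ex_intro _ c0 (proj2 (toI c0) c0P)).
rewrite /gw; set c := classical_sets.xget _ _ => cP.
rewrite pairing_amplitude schubert_num_word -scalerAr mulrA amplitudeZ.
rewrite -rmorphM -[schubert kn y u * _](subrK (\sum_x c x *: schubert kn y x)).
rewrite rmorphD mulrDl amplitudeD amplitude_ideal // add0r.
rewrite raddf_sum mulr_suml amplitude_sum mulr_sumr.
have termE x :
    rev_sign * amplitude w (val (c x *: schubert kn y x) * vdm k A) =
    c x * (x == w)%:R.
  rewrite linearZ -scalerAl amplitudeZ mulrCA -amplitudeZ -schubert_num_word.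
  by rewrite amplitude_word.
rewrite (eq_bigr _ (fun x _ => termE x)) (bigD1 w) //= eqxx mulr1.
rewrite big1 ?addr0 //.
by move=> x /negbTE ->; rewrite mulr0.
Qed.
End Main.

Theorem corollary1p2 (n k : nat) (n_ge2 : (2 <= n)%N) (k_ge1 : (1 <= k)%N)
    (k_le_n : (k <= n)%N) (u v w : grass k n) :
  gw k_le_n (@Rq_y n) (Rq_q n) u v w =
  ext_pairing (grass_wedge k_le_n _ w)
    (ext_act (quantised_chern_root k n (@Rq_y n) (Rq_q n))
       (schubert k_le_n (@Rq_y n) u) (grass_wedge k_le_n _ v)).
Proof.
apply: gw_pairing => // a na; rewrite /Rq_y.
by case: insubP => // i; rewrite ltnNge na.
Qed.
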